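(* Let $s\ge 1$, let $\alpha=(\alpha_1,\dots,\alpha_s)$ be a tuple of positive integers with even sum, and let $g$ be defined by $\sum_{i=1}^s\alpha_i=2g-2$. Let $\mathcal H(\alpha)$ be the corresponding stratum of translation surfaces of genus $g$, let $\mathsf{STS}_n$ be the set of connected square-tiled surfaces made of $n$ unit squares, let $\mathsf{Hol}(O)$ be the set of holonomy vectors of $O$, and let $\mathsf{RP}\subset\mathbb Z^2$ be the set of primitive vectors. The visibility properties of square-tiled surfaces in the fixed stratum $\mathcal H(\alpha)$ are governed by their number of squares $n$ in the following way: (1) There are no square-tiled surfaces in $\mathcal H(\alpha)$ with fewer than $2g+s-2$ squares; that is, if $n<2g+s-2$, then $\mathsf{STS}_n\cap\mathcal H(\alpha)=\emptyset$. (2) $n=2g+s-2$ if and only if $\mathsf{Hol}(O)=\mathsf{RP}$ for all $O\in\mathcal H(\alpha)\cap\mathsf{STS}_n$. (3) If $2g+s-2<n\le 4g+2s-5$, then every $O\in\mathcal H(\alpha)\cap\mathsf{STS}_n$ is a visibility torus; in fact $\mathsf{RP}\subsetneq\mathsf{Hol}(O)$. (4) If $n=4g+2s-4$, then there exists $O\in\mathcal H(\alpha)\cap\mathsf{STS}_n$ that is not a visibility torus. (5) There exists $N(\alpha)$ such that if $n>N(\alpha)$, then no $O\in\mathcal H(\alpha)\cap\mathsf{STS}_n$ is a visibility torus; that is, for each such $O$ there exists $v\in\mathsf{RP}\setminus\mathsf{Hol}(O)$.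
   Context: A translation surface is a closed connected surface obtained from Euclidean polygons in the plane by gluing sides in parallel opposite pairs by translations, considered up to cut-and-paste equivalence. It is flat except at finitely many cone points (singularities) of angle $2\pi m$ with $m\ge 2$ an integer. The stratum $\mathcal H(\alpha_1,\dots,\alpha_s)$ is the set of translation surfaces with exactly $s$ cone points, of angles $2\pi(\alpha_i+1)$, $i=1,\dots,s$; such surfaces have genus $g$ with $\sum\alpha_i=2g-2$. A square-tiled surface (STS) is a translation surface obtained by gluing finitely many unit squares (with horizontal and vertical sides) along parallel opposite sides by translations; equivalently, a translation surface covering the square torus $\mathbb T=\mathbb R^2/\mathbb Z^2$ branched over only one point. $\mathsf{STS}_n$ is the set of connected STSs with $n$ squares. A saddle connection is a straight geodesic segment whose endpoints are cone points and which has no cone points in its interior; its holonomy is the corresponding Euclidean displacement vector in $\mathbb R^2$. $\mathsf{Hol}(O)$ is the set of holonomy vectors of saddle connections of $O$. $\mathsf{RP}=\{(a,b)\in\mathbb Z^2:\gcd(a,b)=1\}$. An STS $O$ is a visibility torus if $\mathsf{RP}\subseteq\mathsf{Hol}(O)$.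
   Formalization: Part (2) is asserted only for n ≥ 2g+s−2: for smaller n the set H(α)∩STS_n is empty by (1), so the right-hand side holds vacuously and the printed equivalence is false. *)

(* Defs.v *)
From Stdlib Require Import Relation_Operators.
From HB Require Import structures.
From mathcomp Require Import all_boot all_order all_algebra perm.
From mathcomp Require Import boolp classical_sets reals.

Set Implicit Arguments.
Unset Strict Implicit.
Unset Printing Implicit Defensive.

Import Order.TTheory GRing.Theory Num.Theory.
Local Open Scope ring_scope.

(* Gluing data for n unit squares labelled by 'I_n: the right side of square i
   is glued to the left side of square (sts_right i), and its top side to the
   bottom side of square (sts_up i). *)
Definition share_side (n : nat) (r u : {perm 'I_n}) : rel 'I_n :=
  [rel i j | [|| j == r i, i == r j, j == u i | i == u j]].

Record square_tiled (n : nat) := SquareTiled {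
  sts_right : {perm 'I_n};
  sts_up : {perm 'I_n};
  sts_nonempty : (0 < n)%N;
  sts_connected : forall i j, connect (share_side sts_right sts_up) i j
}.

Section Surface.
Variables (R : realType) (n : nat).
Implicit Types (O : square_tiled n) (z v : R * R) (t : R).

(* The surface is the quotient of n copies of [0, 1] x [0, 1] by [same_point];
   the pair (i, z) stands for the point z of the i-th square. *)
Definition point : Type := ('I_n * (R * R))%type.

Definition in_square z : bool := (0 <= z.1 <= 1) && (0 <= z.2 <= 1).

Inductive side_glued O : point -> point -> Prop :=
| glued_right i y : 0 <= y <= 1 ->
    side_glued O (i, (1, y)) (sts_right O i, (0, y))
| glued_up i x : 0 <= x <= 1 ->
    side_glued O (i, (x, 1)) (sts_up O i, (x, 0)).

Definition same_point O : point -> point -> Prop :=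
  clos_refl_sym_trans point (side_glued O).

(* (i, (a, b)) is the corner of square i with coordinates (a, b). *)
Definition corner : finType := ('I_n * (bool * bool))%type.

Definition corner_point (c : corner) : point :=
  (c.1, ((c.2.1 : nat)%:R, (c.2.2 : nat)%:R)).

(* A vertex of the tiling is represented by the set of the corners glued to it.
   Each corner contributes pi/2, so the cone angle at V is #|V| * (pi/2), and
   V is a cone point when its angle exceeds 2 * pi, i.e. when #|V| > 4. *)
Definition vertex_of O (c : corner) : {set corner} :=
  [set c' | `[< same_point O (corner_point c) (corner_point c') >]].

Definition cone_points O : {set {set corner}} :=
  [set V in [set vertex_of O c | c : corner] | (4 < #|V|)%N].

Definition is_cone_point O (p : point) : Prop :=
  exists2 c, same_point O p (corner_point c) & vertex_of O c \in cone_points O.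

(* An angle 2 * pi * (a + 1) consists of 4 * (a + 1) right angles. *)
Definition in_stratum O (alpha : seq nat) : Prop :=
  perm_eq [seq #|V : {set corner}| | V in cone_points O]
          [seq (4 * a.+1)%N | a <- alpha].

(* [geodesic O v p t q]: the straight path of constant velocity v starting at p
   arrives at q after time t > 0.  It is cut into segments, each inside one
   square, and no junction point is a cone point.  When v is nonzero no other
   point of the open path can be a cone point, since the corners of a square
   are extreme points of it; at a point which is not a cone point the total
   angle is 2 * pi, so keeping the velocity v means going straight. *)
Inductive geodesic O v : point -> R -> point -> Prop :=
| geodesic_segment i z z' t : 0 < t -> in_square z -> in_square z' ->
    z' = (z.1 + t * v.1, z.2 + t * v.2) ->
    geodesic O v (i, z) t (i, z')
| geodesic_cat p q q' r t t' :
    geodesic O v p t q -> same_point O q q' -> ~ is_cone_point O q ->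
    geodesic O v q' t' r -> geodesic O v p (t + t') r.

(* Holonomy vectors of saddle connections, parametrized on [0, 1]. *)
Definition Hol O : set (R * R) :=
  [set v | v <> (0, 0) /\ exists p q,
     [/\ is_cone_point O p, is_cone_point O q & geodesic O v p 1 q]]%classic.

End Surface.

Arguments Hol R {n} O _.

Definition RP (R : realType) : set (R * R) :=
  [set v | exists a b : int,
     gcdz a b = 1 /\ v = (a%:~R, b%:~R)]%classic.
Arguments RP : clear implicits.

Definition visibility_torus (R : realType) (n : nat) (O : square_tiled n) :
  Prop := (RP R `<=` Hol R O)%classic.
Arguments visibility_torus R {n} O.
Arguments in_stratum R {n} O alpha.

(* Main.v *)
Require Import Defs.
From Stdlib Require Import Relation_Operators.
From mathcomp Require Import all_boot all_order all_algebra all_fingroup.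
From mathcomp Require Import boolp reals.
From mathcomp Require Import zify ring lra.

(* A square-tiled surface is a transitive pair (x, y) of permutations (right, up)
   and its cone points are seen by the set M of the squares whose lower left corner
   is one of them: x and y commute off M, and #|M| = 2g + s - 2 on H(alpha).  The
   maps (x, y) -> (y, x), (x^-1, y), (x, y o x^-1) realize GL_2(Z), preserve #|M|,
   and carry any primitive direction to the horizontal one, where there is a saddle
   connection of length 1 iff x(M) meets M.  This is forced when 2 #|M| > n.

   For (5), if the horizontal cylinders are either short (at most B) or very long,
   some twist y o x^(k B!) has no short closed orbit through M that leaves the short
   cylinders, and inside them it acts as y.  Replacing (x, y) by (y o x^(k B!), x)
   reduces the number of points of M in short cylinders: otherwise all columns
   through these points would be closed and short, and the rows that they meet would
   form the whole surface, of bounded area.  When all the cylinders through M are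
   long, a last twist separates M from its image.

   One-row surfaces in H(alpha) exist for all n >= 2g + s - 2: x is the cycle
   i -> i + 1, and the effect on the commutator of inserting elements in the list of
   the values of y is explicit.  Doubling all squares horizontally kills the saddle
   connections of length 1, which gives (4). *)

Set Implicit Arguments.
Unset Strict Implicit.
Unset Printing Implicit Defensive.

(** * Pairs of permutations that commute off a small set *)

Section RowCombinatorics.

Variables (T : finType) (M : {set T}).
Implicit Types (x y : {perm T}) (p q : T).

(* Here x and y are the moves to the right and up in a square-tiled surface, and M
   contains the squares whose lower left corner is a cone point. *)
Definition commute_off x y :=
  forall p, x (y p) <> y (x p) -> (x (y p) \in M) /\ (y (x p) \in M).

Definition transitive_pair x y :=
  forall U : {set T}, U != set0 -> (forall p, p \in U -> x p \in U) ->
    (forall p, p \in U -> y p \in U) -> U = setT.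

Definition short b x p := [exists c : 'I_b, iter c.+1 x p == p].

(* A step reads the surface in the basis (w + k v, v) instead of (v, w), so that
   some primitive direction has no saddle connection of primitive holonomy. *)
Inductive has_hidden x y : Prop :=
| hidden_now : (forall i, i \in M -> x i \notin M) -> has_hidden x y
| hidden_step k : has_hidden (x ^+ k * y)%g x -> has_hidden x y.

Lemma shortP b x p :
  reflect (exists2 c, 0 < c <= b & iter c x p = p) (short b x p).
Proof.
apply: (iffP existsP) => [[c /eqP e]|]; first by exists c.+1 => //=; apply: ltn_ord.
case=> -[//|c] /= cb e; exists (Ordinal cb); exact/eqP.
Qed.

Lemma short_leq b b' x p : b <= b' -> short b x p -> short b' x p.
Proof.
move=> bb /shortP [c /andP[c0 cb] e]; apply/shortP; exists c => //.
by rewrite c0 (leq_trans cb).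
Qed.

Lemma iter_inj x n : injective (iter n x).
Proof. by elim: n => [|n IH] p q //= /perm_inj/IH. Qed.

Lemma iterMn x p a c : iter c x p = p -> iter (a * c) x p = p.
Proof. by move=> e; elim: a => [|a IH] //=; rewrite mulSn iterD IH. Qed.

Lemma period_iter x p a c : (iter c x (iter a x p) == iter a x p) = (iter c x p == p).
Proof. by rewrite -iterD addnC iterD (inj_eq (@iter_inj x a)). Qed.

Lemma short_iter b x p a : short b x (iter a x p) = short b x p.
Proof. by apply: eq_existsb => c; rewrite period_iter. Qed.

Lemma short_fact b x p k : short b x p -> iter (k * b`!) x p = p.
Proof.
case/shortP => c /andP[c0 cb] e.
have /dvdnP [d ->] : c %| b`! by rewrite dvdn_fact // c0.
by rewrite mulnA iterMn.
Qed.

Lemma long_iter_inj b x p j j' : ~~ short b x p -> j <= b -> j' <= b ->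
  iter j x p = iter j' x p -> j = j'.
Proof.
move=> lp; wlog: j j' / j <= j' => [W|jj _ j'b].
  case/orP: (leq_total j j') => h jb j'b e; first exact: W.
  by rewrite (W j' j).
rewrite -(subnKC jj) iterD => e.
have {}e : iter (j' - j) x p = p.
  by apply: (@iter_inj x j); rewrite -e.
case: (posnP (j' - j)) => [->|h]; first by rewrite addn0.
case/negP: lp; apply/shortP; exists (j' - j) => //; lia.
Qed.

Lemma stable_inv x (U : {set T}) : (forall p, p \in U -> x p \in U) ->
  forall p, (x p \in U) = (p \in U).
Proof.
move=> h p; have e : x @: U = U.
  apply/eqP; rewrite eqEcard card_imset ?leqnn ?andbT; last exact: perm_inj.
  by apply/subsetP => q /imsetP [q' /h hq ->].
by rewrite -{1}e mem_imset //; apply: perm_inj.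
Qed.

Lemma stable_iter x (U : {set T}) : (forall p, p \in U -> x p \in U) ->
  forall a p, (iter a x p \in U) = (p \in U).
Proof. by move=> h; elim=> [|a IH] p //=; rewrite stable_inv. Qed.

Lemma transitive_pairV x y (U : {set T}) : transitive_pair x y -> U != set0 ->
  (forall p, p \in U -> x p \in U) -> (forall p, y p \in U -> p \in U) -> U = setT.
Proof.
move=> tr U0 hx hy; apply: tr => // p pU.
have hV q : q \in U -> (y^-1)%g q \in U by move=> qU; apply: hy; rewrite permKV.
by rewrite -(stable_inv hV) permK.
Qed.

(** With [q = iter k x p], the two composites at [p] are [y (x q)] and [x (y q)], so the set [M] is
    the same for the new pair. *)
Lemma commute_off_step x y k :
  commute_off x y -> commute_off (x ^+ k * y)%g x.
Proof.
move=> h p; rewrite !permM !permX -iterSr iterS => e.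
by have [] := h (iter k x p); [move=> e'; apply: e; rewrite e'|].
Qed.

Lemma transitive_step x y k :
  transitive_pair x y -> transitive_pair (x ^+ k * y)%g x.
Proof.
move=> tr U U0 hy hx; apply: tr => // p pU.
have e := stable_iter hx k ((x ^- k)%g p).
rewrite -permX permKV pU in e.
by have := hy _ (esym e); rewrite permM permKV.
Qed.

(** Two adjacent rows run in parallel until a cone point lies between them; since [M] records lower
    left corners, it is seen from the upper row. *)
Lemma commute_row x y p c : commute_off x y ->
  (forall l, 0 < l <= c -> iter l x (y p) \notin M) ->
  iter c x (y p) = y (iter c x p).
Proof.
move=> cm; elim: c => [//|c IH] h.
have h' := IH (fun l lc => h l ltac:(lia)).
have := h c.+1 ltac:(lia); rewrite !iterS h' => nM.
by apply: contrapT => /cm [xyM _]; rewrite xyM in nM.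
Qed.

(* Descending from a row without singular points reaches a row with the same
   length, so every row is as long as some row through a singular point. *)
Lemma row_with_singularity x y : commute_off x y -> transitive_pair x y ->
  M != set0 -> forall p, exists2 i, i \in M &
    forall c, (iter c x p == p) = (iter c x i == i).
Proof.
move=> cm tr M0.
pose good p := exists2 i, i \in M & forall c, (iter c x p == p) = (iter c x i == i).
have good_iter a p : good (iter a x p) -> good p.
  by case=> i iM h; exists i => // c; rewrite -h period_iter.
pose U := [set p | ~~ `[< good p >]].
have [U0|U0] := eqVneq U set0.
  by move=> p; move/setP/(_ p): U0; rewrite !inE => /negbFE/asboolP.
have UT : U = setT.
  apply: (transitive_pairV tr U0) => p; rewrite !inE; apply: contraNN => /asboolP gp;
    apply/asboolP; first exact: (@good_iter 1).
  have [[l lM]|noM] := pselect (exists l, iter l x (y p) \in M).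
    by apply: (@good_iter l); exists (iter l x (y p)).
  case: gp => i iM h; exists i => // c; rewrite -h (commute_row cm) ?(inj_eq perm_inj) //.
  by move=> l _; apply/negP => lM; apply: noM; exists l.
case/set0Pn: M0 => i iM; have : i \in U by rewrite UT inE.
by rewrite inE => /asboolP []; exists i.
Qed.

Lemma commute_row_up x y p c : commute_off x y ->
  (forall l, 0 < l <= c -> y (iter l x p) \notin M) ->
  y (iter c x p) = iter c x (y p).
Proof.
move=> cm; elim: c => [//|c IH] h.
have h' := IH (fun l lc => h l ltac:(lia)).
have := h c.+1 ltac:(lia); rewrite !iterS -h' => nM.
by apply: contrapT => e; have [|_ yxM] := cm (iter c x p);
  [move=> e'; apply: e | rewrite yxM in nM].
Qed.

(** Pigeonhole: there are n + 1 disjoint blocks of indices and [f] is injective, so the at most n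
    elements of [Q] cannot meet them all. *)
Lemma free_block (Q : {set T}) (f : nat -> T) n w D : 0 < D -> #|Q| <= n ->
  (forall j j', j <= (n * w.+1 + w) * D -> j' <= (n * w.+1 + w) * D ->
     f j = f j' -> j = j') ->
  exists2 t, t <= n & forall j, t * w.+1 * D <= j <= (t * w.+1 + w) * D ->
    f j \notin Q.
Proof.
move=> D0 Qn finj; apply: contrapT => no.
have hit (t : 'I_n.+1) : exists j,
    (t * w.+1 * D <= j <= (t * w.+1 + w) * D) && (f j \in Q).
  apply: contrapT => h; apply: no; exists (t : nat); first exact: ltn_ord t.
  by move=> j jt; apply/negP => fQ; apply: h; exists j; rewrite jt.
pose g (t : 'I_n.+1) := xchoose (hit t).
have gP (t : 'I_n.+1) : (t * w.+1 * D <= g t <= (t * w.+1 + w) * D) /\ f (g t) \in Q.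
  by have /andP := xchooseP (hit t).
have sub : [set f (g t) | t : 'I_n.+1] \subset Q.
  by apply/subsetP => _ /imsetP [t _ ->]; have [] := gP t.
have := subset_leq_card sub; rewrite card_imset ?card_ord; first by lia.
move=> t t' /finj e; have [gt _] := gP t; have [gt' _] := gP t'.
have tn : t < n.+1 := ltn_ord t; have tn' : t' < n.+1 := ltn_ord t'.
have {}e : g t = g t' by apply: e; nia.
apply/val_inj => /=; rewrite -e in gt'.
case: (ltngtP t t') => // tt.
- have : (t * w.+1 + w) * D < t' * w.+1 * D by nia.
  by move: (g t) gt gt' => ?; lia.
- have : (t' * w.+1 + w) * D < t * w.+1 * D by nia.
  by move: (g t) gt gt' => ?; lia.
Qed.

(** Number of twists to start from so that [w] of them survive [a] crossings. Each crossing has m +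
    1 points to avoid, so it cuts its window into m + 2 blocks of w + 1 twists and keeps one. *)
Fixpoint window m a w := if a is a'.+1 then window m a' (m.+2 * w.+1) else w.

Lemma window_ge m a w : w <= window m a w.
Proof. by elim: a w => [|a IH] w //=; apply: leq_trans (IH _); nia. Qed.

(* As k runs over the window, the point reached after [a] crossings moves along
   one long row at speed a * B!; the windows are cut each time that this motion
   meets a singular point or q. *)
Lemma no_return_window x y m B B' q a w s0 :
  let tw k := (x ^+ (k * B`!) * y)%g in
  commute_off x y -> #|M| <= m -> (forall p, short B' x p -> short B x p) ->
  ~~ short B' x q -> 0 < w -> a * window m a w * B`! <= B' ->
  exists2 s, s0 <= s & s + w <= s0 + window m a w /\
    [/\ ~~ short B' x (iter a (tw s) q),
     forall k, s <= k <= s + w ->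
       iter a (tw k) q = iter ((k - s) * (a * B`!)) x (iter a (tw s) q) &
     forall k a', s <= k <= s + w -> 0 < a' <= a -> iter a' (tw k) q <> q].
Proof.
move=> tw cm Mm gap lq.
have L0 : 0 < B`! := fact_gt0 B.
elim: a w => [|a IH] w w0 /= wB.
  exists s0 => //; split=> //; split=> // k; last by move=> a' _; lia.
  by rewrite mul0n muln0.
have wW := window_ge m a (m.+2 * w.+1).
have [||s1 s01 [s1w [ls1 p_lin p_ne]]] := IH (m.+2 * w.+1); first by lia.
  by apply: leq_trans wB; rewrite leq_mul2r leq_mul2r leqnSn !orbT.
set W := window _ _ _ in wB wW s1w *.
pose e := iter (s1 * B`!) x (iter a (tw s1) q).
pose f j := y (iter j x e).
(* One more twist moves the point by [a * B!] from the earlier crossings and by [B!] from the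
   current one. *)
set D := a.+1 * B`!.
have WD : W * D <= B' by rewrite /D; nia.
have le : ~~ short B' x e by rewrite short_iter.
have finj j j' : j <= B' -> j' <= B' -> f j = f j' -> j = j'.
  by move=> jB jB' /perm_inj; apply: long_iter_inj le jB jB'.
have D0 : 0 < D by rewrite muln_gt0.
have pS k : s1 <= k <= s1 + m.+2 * w.+1 -> iter a.+1 (tw k) q = f ((k - s1) * D).
  move=> kw; rewrite iterS p_lin // /tw permM permX -iterD /f /e -iterD.
  congr (y (iter _ x _)); rewrite /D.
  by have [d ->] : exists d, k = s1 + d; [exists (k - s1); lia | rewrite addKn; nia].
have cardQ : #|q |: M| <= m.+1.
  by rewrite cardsU1; case: (q \in M); rewrite ?add0n ?add1n //; lia.
have bound : (m.+1 * w.+1 + w) * D <= B' by nia.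
have [t tm free] := @free_block (q |: M) f m.+1 w D D0 cardQ
  (fun j j' jb jb' => finj j j' (leq_trans jb bound) (leq_trans jb' bound)).
pose s := s1 + t * w.+1.
have tw_le : t * w.+1 + w <= m.+2 * w.+1.
  by rewrite mulSn addnC leq_add // leq_mul.
have inside k : s <= k <= s + w -> s1 <= k <= s1 + m.+2 * w.+1 by rewrite /s; lia.
have lin c : c <= w * D -> f ((s - s1) * D + c) = iter c x (f ((s - s1) * D)).
  move=> cw; rewrite /f addnC iterD; apply: commute_row_up => // l lc.
  rewrite -iterD; have := free (l + (s - s1) * D); rewrite in_setU1 negb_or.
  by rewrite /s addKn => /(_ ltac:(lia)) /andP[].
exists s; first by rewrite /s; lia.
split; first by rewrite /s; lia.
split.
(* The new row is long: otherwise [gap] gives it a period at most B, which [lin] turns into a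
   repetition of [f] inside the free block. *)
- rewrite -iterS pS; last by apply: inside; lia.
  apply/negP => /gap /shortP [c /andP[c0 cB]].
  have cL : c <= B`! := leq_trans cB (fact_geq B).
  have cD : c <= w * D.
    by apply: leq_trans cL _; rewrite /D mulnA leq_pmull // muln_gt0 w0.
  rewrite -lin // => /finj; rewrite /s addKn.
  have : t * w.+1 * D + c <= B'.
    by apply: leq_trans bound; rewrite mulnDl leq_add // leq_mul // leq_mul.
  by move=> h /(_ h); lia.
- move=> k ks; rewrite -!iterS !pS; [|by apply: inside; lia|exact: inside].
  rewrite -lin; last by rewrite -/D leq_pmul2r // leq_subLR; case/andP: ks.
  by congr f; rewrite -/D -mulnDl; congr (_ * _); rewrite /s; lia.
- move=> k a' ks /andP[a'0]; rewrite leq_eqVlt => /orP [/eqP -> e'|a'a].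
    have := free ((k - s1) * D); rewrite -pS; last exact: inside.
    by rewrite e' in_setU1 eqxx !leq_pmul2r // => /(_ ltac:(rewrite /s in ks; lia)).
  by apply: p_ne; [exact: inside | lia].
Qed.

(** The points of [qs] are treated one after the other, each within the window of twists left by the
    previous ones; hence the iterated [window]. *)
Lemma no_return_twist x y m B B' b (qs : seq T) n :
  let tw k := (x ^+ (k * B`!) * y)%g in
  commute_off x y -> #|M| <= m -> (forall p, short B' x p -> short B x p) ->
  (forall q, q \in qs -> ~~ short B' x q) -> size qs <= n ->
  b * iter n (window m b) 1 * B`! <= B' ->
  exists k, forall q a, q \in qs -> 0 < a <= b -> iter a (tw k) q <> q.
Proof.
move=> tw cm Mm gap; set V := fun n => iter n (window m b) 1.
have V0 r : 0 < V r by elim: r => [//|r IH]; apply: leq_trans IH (window_ge _ _ _).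
suff main r s : (forall q, q \in qs -> ~~ short B' x q) -> size qs <= r ->
    b * V r * B`! <= B' -> exists2 k, s <= k <= s + V r &
    forall q a, q \in qs -> 0 < a <= b -> iter a (tw k) q <> q.
  by move=> lqs sn VB; have [k _ kP] := main n 0 lqs sn VB; exists k.
elim: qs r s => [|q qs IH] [//|r] s lqs sr VB; [by exists s => //; lia..|].
have [s1 s01 [s1w [_ _ q_ne]]] :=
  no_return_window s cm Mm gap (lqs q (mem_head _ _)) (V0 r) VB.
have VS : V r <= V r.+1 := window_ge _ _ _.
have [|||k ks qs_ne] := IH r s1.
- by move=> q' q'qs; apply: lqs; rewrite inE q'qs orbT.
- by [].
- by apply: leq_trans VB; rewrite !leq_mul.
exists k; first by change (iter r (window m b) 1) with (V r) in s1w; rewrite /V iterS -/(V r); lia.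
move=> q' a; rewrite inE => /orP [/eqP -> ab|q'qs]; last exact: qs_ne.
by apply: q_ne => //; lia.
Qed.

(** On short rows the twist by a multiple of [B!] is invisible, so the orbit follows [y] up to its
    first point on a long row. That point would lie on the same closed orbit and return within b
    steps, which the hypothesis excludes. *)
Lemma short_tracks x y B b k i :
  let tw k := (x ^+ (k * B`!) * y)%g in
  (forall a, a < b -> ~~ short B x (iter a y i) ->
     forall c, 0 < c <= b -> iter c (tw k) (iter a y i) <> iter a y i) ->
  short b (tw k) i ->
  forall a, short B x (iter a (tw k) i) /\ iter a (tw k) i = iter a y i.
Proof.
move=> tw ne /shortP [c cb ce].
have sh a : short B x (iter a (tw k) i).
  apply: contraT => la.
  have ex : exists a, ~~ short B x (iter a (tw k) i) by exists a.
  have [a0 la0 a0min] := ex_minnP ex.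
  have a0c : a0 < c.
    rewrite ltnNge; apply/negP => h; have := a0min (a0 - c).
    have e : iter (a0 - c) (tw k) i = iter a0 (tw k) i.
      by rewrite -{2}(subnK h) iterD ce.
    by rewrite e la0 => /(_ isT); lia.
  have e r : r <= a0 -> iter r (tw k) i = iter r y i.
    elim: r => [//|r IH] ra0; rewrite !iterS -IH ?(ltnW ra0) // permM permX.
    by rewrite short_fact //; apply: contraT => /a0min; lia.
  have := ne a0 ltac:(lia); rewrite -e // => /(_ la0 c cb) [].
  by rewrite -iterD addnC iterD ce.
move=> a; split=> //; elim: a => [//|a IH].
by rewrite !iterS -IH permM permX short_fact.
Qed.

Lemma short_mod b x p c : short b x p -> exists2 c', c' < b & iter c x p = iter c' x p.
Proof.
case/shortP => d /andP[d0 db] e; exists (c %% d); first by rewrite (leq_trans _ db) // ltn_mod.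
by rewrite {1}(divn_eq c d) addnC iterD iterMn.
Qed.

Lemma short_back b x p c : short b x p -> exists d, iter d x (iter c x p) = p.
Proof.
move=> h; exists (c * b`! - c); rewrite -iterD subnK ?short_fact //.
by rewrite leq_pmulr // fact_gt0.
Qed.

(* The rows issued from closed columns through singular points are stable under
   y^-1: a point whose row carries singular points lies to the right of one of
   them, and the column of that one is closed. *)
Lemma card_of_closed_columns x y B b : commute_off x y -> transitive_pair x y ->
  (exists2 i, i \in M & short B x i) ->
  (forall i, i \in M -> short B x i ->
     short b y i /\ forall a, short B x (iter a y i)) ->
  #|T| <= #|M| * b * B.
Proof.
move=> cm tr [i0 i0M si0] cl.
pose U := [set iter (t.2 : 'I_B) x (iter (t.1.2 : 'I_b) y t.1.1)
  | t : T * 'I_b * 'I_B & (t.1.1 \in M) && short B x t.1.1].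
have inU p : p \in U <-> exists i a c,
    [/\ i \in M, short B x i & p = iter c x (iter a y i)].
  split; first by case/imsetP => -[[i a] c]; rewrite inE => /andP[/= iM si] ->;
    exists i, a, c.
  case=> i [a [c [iM si ->]]]; have [sb sB] := cl i iM si.
  have [a' a'b ->] := short_mod a sb.
  have [c' c'B ->] := short_mod c (sB a').
  by apply/imsetP; exists ((i, Ordinal a'b), Ordinal c'B); rewrite // inE iM.
have U_right i l : i \in M -> short B x (iter l x i) -> iter l x i \in U.
  by move=> iM; rewrite short_iter => si; apply/inU; exists i, 0, l.
have UT : U = setT.
  apply: (transitive_pairV tr).
  - by apply/set0Pn; exists i0; apply/inU; exists i0, 0, 0.
  - by move=> p /inU [i [a [c [iM si ->]]]]; apply/inU; exists i, a, c.+1.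
  move=> p /inU [i [a [c [iM si e]]]].
  have [[l0 [j0 [j0M e0]]]|noM] :=
      pselect (exists l j, j \in M /\ y p = iter l x j).
    have ex : exists l, [exists j in M, y p == iter l x j].
      by exists l0; apply/existsP; exists j0; rewrite j0M e0 /=.
    (* By minimality of [l], no point of [M] separates [j] from [y p], so the row can be pulled down
       along the closed column of [j]. *)
    have [l /existsP [j /andP[jM /eqP ej]] lmin] := ex_minnP ex.
    have sj : short B x j.
      have := (cl i iM si).2 a.
      by rewrite -(short_iter _ _ _ c) -e ej short_iter.
    have [/shortP [d /andP[d0 _] de] _] := cl j jM sj.
    apply/inU; exists j, d.-1, l; split=> //; apply: (@perm_inj _ y).
    rewrite -(commute_row cm) -?iterS ?prednK ?de // => r /andP[r0 rl].
    apply/negP => rM; have := lmin (l - r).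
    have -> : [exists j' in M, y p == iter (l - r) x j'].
      by apply/existsP; exists (iter r x j); rewrite rM ej /= -iterD subnK.
    by move=> /(_ isT); move: r0 rl; clear; lia.
  (* For [a = 0] the row of [y p] contains [i], a point of [M]; otherwise the row below is the
     previous one of the same column. *)
  case: a e => [|a] e; first by case: noM; exists c, i.
  apply/inU; exists i, a, c; split=> //; apply: (@perm_inj _ y).
  rewrite -(commute_row cm) // => r _; apply/negP => rM; apply: noM.
  have sr : short B x (y (iter a y i)) by rewrite -iterS; apply: (cl i iM si).2.
  have [d de] := short_back r sr.
  by exists (c + d), (iter r x (y (iter a y i))); rewrite iterD de.
rewrite -cardsT -UT (leq_trans (leq_imset_card _ _)) //.
have /subset_leq_card : [set t : T * 'I_b * 'I_B | (t.1.1 \in M) && short B x t.1.1]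
    \subset setX (setX M setT) setT.
  by apply/subsetP => -[[i a] c]; rewrite !inE /= => /andP[-> _].
by move=> h; apply: leq_trans h _; rewrite !cardsX !cardsT !card_ord.
Qed.

Definition row_gap B B' x := forall p, short B' x p -> short B x p.

(** Every row length is the length of a row through [M], so at most [#|M|] lengths occur, and one of
    the [#|M| + 1] successive intervals contains none. *)
Lemma row_gap_exists (bs : nat -> nat) x y : (forall t, bs t <= bs t.+1) ->
  commute_off x y -> transitive_pair x y -> M != set0 ->
  exists2 t, t <= #|M| & row_gap (bs t) (bs t.+1) x.
Proof.
move=> bsS cm tr M0; apply: contrapT => no.
have bs_le t t' : t <= t' -> bs t <= bs t'.
  by move=> h; apply: (homo_leq (r := leq)) h => //; exact: leq_trans.
have ex (t : 'I_#|M|.+1) : exists i, [&& i \in M, short (bs t.+1) x i & ~~ short (bs t) x i].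
  apply: contrapT => h; apply: no; exists (t : nat); first exact: ltn_ord t.
  move=> p sp; apply: contraT => lp; case: h.
  have [i iM ie] := row_with_singularity cm tr M0 p.
  have se b : short b x p = short b x i by apply: eq_existsb => c; rewrite ie.
  by exists i; rewrite iM -!se sp.
pose f t := xchoose (ex t).
have fP t : [/\ f t \in M, short (bs t.+1) x (f t) & ~~ short (bs t) x (f t)].
  by have /and3P := xchooseP (ex t).
have finj : injective f.
  move=> t t' e; apply/val_inj => /=; have [_ s1 l1] := fP t; have [_ s2 l2] := fP t'.
  rewrite e in s1 l1; case: (ltngtP t t') => // tt; exfalso.
    by move/negP: l2; apply; apply: short_leq s1; apply: bs_le.
  by move/negP: l1; apply; apply: short_leq s2; apply: bs_le.
have sub : f @: setT \subset M by apply/subsetP => _ /imsetP [t _ ->]; have [] := fP t.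
by have := subset_leq_card sub; rewrite card_imset // cardsT card_ord ltnn.
Qed.

End RowCombinatorics.

(** * Induction on the number of singular points in short rows *)

Definition gap_hides m d B B' N :=
  forall (T : finType) (M : {set T}) (x y : {perm T}),
    commute_off M x y -> transitive_pair x y -> #|M| <= m -> N < #|T| ->
    row_gap B B' x -> #|[set i in M | short B x i]| <= d -> has_hidden M x y.

(** If each twist k from 0 to m * m sent some point of [M] into [M], two of them would share the
    same source and target. The row of the source would then have length at most m * m, but it is
    long. *)
Lemma gap_hides0 m B : gap_hides m 0 B (B + m * m) 0.
Proof.
move=> T M x y cm tr Mm _ gap; rewrite leqn0 cards_eq0 => /eqP S0.
have long i : i \in M -> ~~ short (B + m * m) x i.
  move=> iM; apply/negP => /gap si; have : i \in [set i in M | short B x i].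
    by rewrite inE iM.
  by rewrite S0 inE.
apply: contrapT => nh.
have ex (k : 'I_(m * m).+1) : exists t : T * T,
    [&& t.1 \in M, t.2 \in M & y (iter k x t.1) == t.2].
  apply: contrapT => h; apply: nh; apply: (hidden_step (k := k)); apply: hidden_now.
  move=> i iM; apply/negP => jM; apply: h; exists (i, y (iter k x i)).
  by rewrite /= iM eqxx -permX -permM jM.
pose f k := xchoose (ex k).
have fP k : [/\ (f k).1 \in M, (f k).2 \in M & y (iter k x (f k).1) = (f k).2].
  by have /and3P [? ? /eqP] := xchooseP (ex k).
have finj : injective f.
  move=> k k' e; have [iM _ e1] := fP k; have [_ _ e2] := fP k'.
  rewrite -e -e1 in e2; move/perm_inj in e2; apply/val_inj/esym => /=.
  by apply: long_iter_inj (long _ iM) _ _ e2; [move: (ltn_ord k')|move: (ltn_ord k)]; lia.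
have sub : f @: setT \subset setX M M.
  by apply/subsetP => _ /imsetP [t _ ->]; have [iM jM _] := fP t; rewrite (surjective_pairing (f t)) in_setX iM.
have := subset_leq_card sub; rewrite card_imset // cardsT card_ord cardsX.
by have := leq_mul Mm Mm; lia.
Qed.

(** A suitable twist gives a pair [(tw, x)] with fewer points of [M] in short rows. The induction
    hypothesis needs a gap for [tw], at a scale not known in advance, so all the possible scales
    [bs t] are prepared. *)
Lemma gap_hides_exists m d B : exists B' N, B <= B' /\ gap_hides m d B B' N.
Proof.
elim: d B => [|d IH] B.
  by exists (B + m * m), 0; split; [exact: leq_addr | exact: gap_hides0].
have /boolp.choice [F FP] C : exists BN : nat * nat,
    C <= BN.1 /\ gap_hides m d C BN.1 BN.2.
  by have [B' [N h]] := IH C; exists (B', N).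
pose bs t := iter t (fun C => (F C).1) B.
have bsS t : bs t <= bs t.+1 by have [] := FP (bs t).
have bs_le t t' : t <= t' -> bs t <= bs t'.
  by move=> h; apply: (homo_leq (r := leq)) h => //; exact: leq_trans.
(* [b] bounds every scale at which a gap of [tw] may be found. *)
pose b := bs m.+1.
(* The first term suits [no_return_twist] for the at most m * b points [iter a y i] with [i] in [M]
   and [a < b]; the second ensures [B <= B']. *)
exists (b * iter (m * b) (window m b) 1 * B`! + B).
(* The maximum serves the induction hypothesis at any scale; [m * b * B] is the area bound given by
   closed columns. *)
exists (\max_(t < m.+1) (F (bs t)).2 + m * b * B); split; first exact: leq_addl.
move=> T M x y cm tr Mm NT gap Sd.
have [M0|M0] := eqVneq M set0; first by apply: hidden_now => i; rewrite M0 inE.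
pose qs := [seq q <- [seq iter a y i | i <- enum M, a <- iota 0 b] | ~~ short B x q].
have qs_long q : q \in qs -> ~~ short (b * iter (m * b) (window m b) 1 * B`! + B) x q.
  by rewrite mem_filter => /andP[h _]; apply: contraNN h => /gap.
have qs_size : size qs <= m * b.
  rewrite size_filter (leq_trans (count_size _ _)) // size_allpairs size_iota -cardE.
  by rewrite leq_mul2r Mm orbT.
have [k kP] := no_return_twist cm Mm gap qs_long qs_size (leq_addr _ _).
set tw := (x ^+ (k * B`!) * y)%g in kP.
have track i : i \in M -> short b tw i ->
    forall a, short B x (iter a tw i) /\ iter a tw i = iter a y i.
  move=> iM; apply: short_tracks => a ab la c cb; apply: kP => //.
  rewrite mem_filter la; apply: allpairs_f; rewrite ?mem_enum //.
  by rewrite mem_iota.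
apply: (hidden_step (k := k * B`!)); rewrite -/tw.
have cm' : commute_off M tw x by apply: commute_off_step.
have tr' : transitive_pair tw x by apply: transitive_step.
have [t tM gt] := row_gap_exists bsS cm' tr' M0.
have tm : t <= m := leq_trans tM Mm.
have tb : bs t <= b by apply: bs_le; lia.
have N_t : (F (bs t)).2 < #|T|.
  have := @leq_bigmax _ (fun t : 'I_m.+1 => (F (bs t)).2) (Ordinal (n := m.+1) (m := t) tm).
  by move=> /= h; apply: leq_ltn_trans NT; apply: leq_trans h (leq_addr _ _).
apply: (FP (bs t)).2 => //.
set S1 := [set _ in _ | _]; set S0 := [set _ in _ | _] in Sd.
have S10 : S1 \subset S0.
  apply/subsetP => i; rewrite !inE => /andP[iM si]; rewrite iM.
  by have [] := track i iM (short_leq tb si) 0.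
(* If the number did not drop, all the points of [S0] would have closed short columns staying in
   short rows, and the area would be bounded. *)
rewrite leqNgt; apply/negP => S1d.
have S01 : S1 = S0 by apply/eqP; rewrite eqEcard S10 (leq_trans Sd).
have [i0 i0S] : exists i, i \in S0.
  by apply/set0Pn; rewrite -S01 -card_gt0; lia.
have TN : #|T| <= #|M| * bs t * B.
  apply: (card_of_closed_columns cm tr).
  - by exists i0; move: i0S; rewrite inE => /andP[].
  - move=> i iM si; have : i \in S1 by rewrite S01 inE iM.
    rewrite inE => /andP[_ st]; have tr_i := track i iM (short_leq tb st).
    split; last by move=> a; have [h <-] := tr_i a.
    case/shortP: st => c cb e; apply/shortP; exists c => //.
    by have [_ <-] := tr_i c.
have : #|M| * bs t * B <= m * b * B by rewrite leq_mul // leq_mul.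
by have := leq_trans TN; lia.
Qed.

(** The scales are iterated from 0, so some gap exists for any pair, and [d = m] bounds the points
    of [M] in short rows trivially. *)
Theorem hidden_direction m : exists N, forall (T : finType) (M : {set T}) (x y : {perm T}),
  commute_off M x y -> transitive_pair x y -> #|M| <= m -> N < #|T| -> has_hidden M x y.
Proof.
have /boolp.choice [F FP] C : exists BN : nat * nat,
    C <= BN.1 /\ gap_hides m m C BN.1 BN.2.
  by have [B' [N h]] := gap_hides_exists m m C; exists (B', N).
pose bs t := iter t (fun C => (F C).1) 0.
have bsS t : bs t <= bs t.+1 by have [] := FP (bs t).
exists (\max_(t < m.+1) (F (bs t)).2) => T M x y cm tr Mm NT.
have [M0|M0] := eqVneq M set0; first by apply: hidden_now => i; rewrite M0 inE.
have [t tM gt] := row_gap_exists bsS cm tr M0.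
have tm : t <= m := leq_trans tM Mm.
apply: (FP (bs t)).2 => //.
  have := @leq_bigmax _ (fun t : 'I_m.+1 => (F (bs t)).2) (Ordinal (n := m.+1) (m := t) tm).
  by move=> /= h; apply: leq_ltn_trans NT.
by apply: leq_trans Mm; apply: subset_leq_card; apply/subsetP => i; rewrite inE => /andP[].
Qed.

(** * One-row surfaces with prescribed cone angles *)

Section OneRow.

Implicit Types (s p t c a : seq nat) (cs : seq (seq nat)).

(* Squares 0, ..., n - 1 form one horizontal row and the top of square i is glued
   to the bottom of square s_i; then [turn s] is the rotation around the vertices:
   it sends s_(i+1) to s_i + 1, and s_0 to 0 because s ends with n - 1. *)
Definition turn s j := last 0 [seq x.+1 | x <- take (index j s) s].

(** The second condition says that a nonempty [s] ends with its largest value, in a form that also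
    holds for the empty list. The lists in [cs] are the cycles of [turn s], fixed points
    included. *)
Definition one_row s cs := [/\ perm_eq s (iota 0 (size s)),
  last 0 [seq x.+1 | x <- s] = size s, perm_eq (flatten cs) s &
  forall c, c \in cs -> map (turn s) c = rot 1 c].

Definition realizable a := exists s cs,
  one_row s cs /\ perm_eq (map size cs) (map succn a).

Lemma turn_cat p j t : j \notin p -> turn (p ++ j :: t) j = last 0 [seq x.+1 | x <- p].
Proof.
move=> jp; rewrite /turn index_cat (negbTE jp) /= eqxx addn0.
by rewrite take_size_cat.
Qed.

Lemma turn_catl s t j : j \in s -> turn (s ++ t) j = turn s j.
Proof.
move=> js; rewrite /turn index_cat js takel_cat //.
by rewrite ltnW // index_mem.
Qed.

Lemma one_row_mem s cs j : one_row s cs -> (j \in s) = (j < size s).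
Proof. by case=> /perm_mem -> *; rewrite mem_iota. Qed.

Lemma one_row_uniq s cs : one_row s cs -> uniq s.
Proof. by case=> /perm_uniq -> *; rewrite iota_uniq. Qed.

Lemma cycle_mem s cs c j : one_row s cs -> c \in cs -> j \in c -> j \in s.
Proof.
by case=> _ _ /perm_mem h _ ccs jc; rewrite -h; apply/flattenP; exists c.
Qed.

Lemma cycle_eq s cs c f : one_row s cs -> c \in cs ->
  {in c, f =1 turn s} -> map f c = rot 1 c.
Proof. by case=> _ _ _ h ccs /eq_in_map ->; apply: h. Qed.

Lemma perm_iota_cat s t : perm_eq s (iota 0 (size s)) ->
  perm_eq t (iota (size s) (size t)) ->
  perm_eq (s ++ t) (iota 0 (size (s ++ t))).
Proof. by move=> hs ht; rewrite size_cat iotaD add0n perm_cat. Qed.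

Lemma one_row_cat s t cs ct : one_row s cs -> perm_eq t (iota (size s) (size t)) ->
  last (size s) [seq x.+1 | x <- t] = size s + size t -> perm_eq (flatten ct) t ->
  (forall c, c \in ct -> map (turn (s ++ t)) c = rot 1 c) ->
  one_row (s ++ t) (ct ++ cs).
Proof.
move=> os ht lt pt ht'; have [ps ls fs _] := os; split.
- exact: perm_iota_cat.
- by rewrite map_cat last_cat ls lt size_cat.
- by rewrite flatten_cat perm_catC perm_cat.
move=> c; rewrite mem_cat => /orP [/ht' //|ccs].
apply: (cycle_eq os ccs) => j jc; apply: turn_catl; exact: cycle_mem os ccs jc.
Qed.

Lemma realizable_nil : realizable [::].
Proof. by exists [::], [::]. Qed.

Lemma realizable0 a : realizable a -> realizable (0 :: a).
Proof.
case=> s [cs [os pa]]; exists (s ++ [:: size s]), ([:: [:: size s]] ++ cs).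
split; last by rewrite /= perm_cons.
have nin : size s \notin s by rewrite (one_row_mem _ os) ltnn.
apply: one_row_cat => //=; first by rewrite addn1.
move=> c; rewrite inE => /eqP -> /=; congr [:: _].
by rewrite turn_cat //; case: os.
Qed.

(** Appending n+2, n+1, n, n+3 adds exactly the two transpositions (n, n+2) and (n+1, n+3) to
    [turn]. *)
Lemma realizable11 a : realizable a -> realizable (1 :: 1 :: a).
Proof.
case=> s [cs [os pa]]; set n := size s.
pose t := [:: n.+2; n.+1; n; n.+3].
exists (s ++ t), ([:: [:: n; n.+2]; [:: n.+1; n.+3]] ++ cs).
split; last by rewrite /= !perm_cons.
have nin k : n + k \notin s by rewrite (one_row_mem _ os) -leqNgt leq_addr.
have h0 : n \notin s by have := nin 0; rewrite addn0.
have h1 : n.+1 \notin s by have := nin 1; rewrite addn1.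
have h2 : n.+2 \notin s by have := nin 2; rewrite addn2.
have h3 : n.+3 \notin s by have := nin 3; rewrite addn3.
have ls : last 0 [seq x.+1 | x <- s] = n by case: os.
apply: one_row_cat => //=.
- apply/seq.permP => P /=.
  by move: (P n : nat) (P n.+1 : nat) (P n.+2 : nat) (P n.+3 : nat); clear; lia.
- by rewrite addn4.
- apply/seq.permP => P /=.
  by move: (P n : nat) (P n.+1 : nat) (P n.+2 : nat) (P n.+3 : nat); clear; lia.
have e2 : turn (s ++ t) n.+2 = n by rewrite turn_cat // ls.
have e1 : turn (s ++ t) n.+1 = n.+3.
  rewrite /t -cat_rcons turn_cat ?map_rcons ?last_rcons //.
  by rewrite mem_rcons inE negb_or h1 andbT; lia.
have e0 : turn (s ++ t) n = n.+2.
  rewrite /t -2!cat_rcons turn_cat ?map_rcons ?last_rcons //.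
  by rewrite !(mem_rcons, inE) !negb_or h0 !andbT; lia.
have e3 : turn (s ++ t) n.+3 = n.+1.
  rewrite /t -3!cat_rcons turn_cat ?map_rcons ?last_rcons //.
  by rewrite !(mem_rcons, inE) !negb_or h3 !andbT; lia.
by move=> c; rewrite !inE => /orP [] /eqP -> /=; rewrite ?e0 ?e1 ?e2 ?e3.
Qed.

Lemma realizable_perm a b : perm_eq a b -> realizable a -> realizable b.
Proof.
move=> ab [s [cs [os pa]]]; exists s, cs; split=> //.
by apply: perm_trans pa _; apply: perm_map.
Qed.

(** Inserting n just before an entry e of the cycle and n+1 at the end replaces the arrow from e to
    [turn s e] by the path e, n+1, n, [turn s e]; all other arrows remain. *)
Lemma realizable_add2 b a : realizable (b :: a) -> realizable (b.+2 :: a).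
Proof.
case=> s [cs [os pa]]; set n := size s.
have /mapP [c ccs cb] : b.+1 \in map size cs by rewrite (perm_mem pa) mem_head.
case: c ccs cb => [//|e c] ccs [cb].
have es : e \in s by apply: cycle_mem os ccs (mem_head _ _).
have us := one_row_uniq os.
have nin : n \notin s by rewrite (one_row_mem _ os) ltnn.
have nin1 : n.+1 \notin s by rewrite (one_row_mem _ os) -leqNgt.
have [ps ls fs _] := os.
have lts x : x \in s -> x < n by rewrite (one_row_mem _ os).
case/splitPr def_s : s / es => [s1 s2].
rewrite def_s in us nin nin1 lts.
move: us; rewrite cat_uniq /= !negb_or => /and4P [us1 /andP[es1 hs12] es2 us2].
move: nin nin1; rewrite !mem_cat !inE !negb_or => /and3P[n1 ne n2] /and3P[m1 me m2].
pose s' := s1 ++ n :: e :: rcons s2 n.+1.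
have size_s' : size s' = n.+2.
  by rewrite /s' size_cat /= size_rcons /n def_s size_cat /= !addnS.
have ps' : perm_eq s' (n :: n.+1 :: s).
  apply/seq.permP => P; rewrite /s' def_s -cats1 /= !count_cat /= count_cat /=.
  by move: (P e : nat) (P n : nat) (P n.+1 : nat); clear; lia.
have tn : turn s' n = turn s e by rewrite def_s !turn_cat.
have te : turn s' e = n.+1.
  rewrite /s' -cat_rcons turn_cat ?map_rcons ?last_rcons //.
  by rewrite mem_rcons inE negb_or es1 eq_sym ne.
have tn1 : turn s' n.+1 = n.
  have -> : s' = (s1 ++ n :: e :: s2) ++ [:: n.+1] by rewrite /s' -cats1 -catA.
  rewrite turn_cat.
    by rewrite -[RHS]ls def_s !map_cat !last_cat.
  by rewrite mem_cat !inE !negb_or m1 me m2 gtn_eqF.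
have tj j : j \in s -> j != e -> turn s' j = turn s j.
  rewrite def_s mem_cat inE => /or3P [js1 _|-> //|js2 je].
    by rewrite !turn_catl.
  case/splitPr def2 : s2 / js2 => [p t].
  rewrite def2 cat_uniq /= !negb_or in us2.
  have jp : j \notin p by case/and4P: us2 => _ /andP[].
  have js1 : j \notin s1.
    by move: hs12; rewrite def2 has_cat /= !negb_or => /and3P[].
  have jn : j != n by apply: contraNneq n2 => <-; rewrite def2 mem_cat mem_head orbT.
  have -> : s' = (s1 ++ n :: e :: p) ++ j :: rcons t n.+1.
    by rewrite /s' def2 rcons_cat -catA.
  have -> : s1 ++ e :: p ++ j :: t = (s1 ++ e :: p) ++ j :: t by rewrite -catA.
  rewrite !turn_cat ?mem_cat ?inE ?negb_or ?js1 ?je ?jp ?jn //.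
  by rewrite !map_cat !last_cat.
have uniq_fl : uniq (flatten cs) by rewrite (perm_uniq fs) (one_row_uniq os).
have pcs : perm_eq cs ((e :: c) :: rem (e :: c) cs) := perm_to_rem ccs.
have pfl : perm_eq (flatten cs) (e :: c ++ flatten (rem (e :: c) cs)).
  exact: (perm_flatten pcs).
have := uniq_fl; rewrite (perm_uniq pfl) /= mem_cat negb_or => /andP[/andP[ec er] _].
exists s', ([:: e, n.+1, n & c] :: rem (e :: c) cs); split; last first.
  have := perm_map size pcs; rewrite perm_sym => h.
  have := perm_trans h pa; rewrite /= -cb perm_cons => h'.
  by rewrite perm_cons.
split.
- rewrite size_s' (perm_trans ps') //.
  rewrite -[iota 0 n.+2]/(iota 0 (2 + n)) addnC iotaD add0n /= -/n.
  by rewrite -[n :: n.+1 :: s]/([:: n; n.+1] ++ s) perm_catC perm_cat2r.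
- by rewrite size_s' /s' map_cat last_cat /= map_rcons last_rcons.
- apply: (@perm_trans _ (n :: n.+1 :: e :: c ++ flatten (rem (e :: c) cs))).
    apply/seq.permP => P /=.
    by move: (P e : nat) (P n : nat) (P n.+1 : nat); clear; lia.
  rewrite perm_sym (perm_trans ps') // !perm_cons.
  by apply: perm_trans pfl; rewrite perm_sym.
move=> d; rewrite inE => /orP [/eqP -> /=|dcs].
  rewrite te tn1 tn; have := cycle_eq os ccs (fun j _ => erefl (turn s j)).
  rewrite !rot1_cons !rcons_cons => <-; congr [:: _, _, _ & _].
  apply/eq_in_map => j jc; apply: tj; last by apply: contraNneq ec => <-.
  by apply: cycle_mem os ccs _; rewrite inE jc orbT.
have dcs' : d \in cs by apply: mem_rem dcs.
apply: (cycle_eq os dcs') => j jd; apply: tj; first exact: cycle_mem os dcs' jd.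
by apply: contraNneq er => je; apply/flattenP; exists d; rewrite // -je.
Qed.

(** Steps of 2 reduce every entry to its parity; the ones left are even in number and are added in
    pairs. *)
Lemma realizable_even a : ~~ odd (sumn a) -> realizable a.
Proof.
have base u v : ~~ odd u -> realizable (nseq u 1 ++ nseq v 0).
  move=> u_even; have -> : u = (u./2).*2 by rewrite -{1}(odd_double_half u) (negbTE u_even).
  elim: u./2 => [|w IH] /=; last exact: realizable11.
  by elim: v => [|v IH]; [exact: realizable_nil | exact: realizable0].
have raise b k t : realizable (b :: t) -> realizable (b + k.*2 :: t).
  elim: k => [|k IH] h; first by rewrite addn0.
  by rewrite doubleS !addnS; apply: realizable_add2; apply: IH.
have lift t v : realizable ([seq (odd x : nat) | x <- t] ++ v) -> realizable (t ++ v).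
  elim: t v => [//|x t IH] v /(raise _ x./2) /=; rewrite odd_double_half => h.
  have {}h : realizable ([seq (odd x : nat) | x <- t] ++ x :: v).
    by apply: realizable_perm h; rewrite perm_sym perm_catC /= perm_cons perm_catC.
  by apply: realizable_perm (IH _ h); rewrite perm_catC /= perm_cons perm_catC.
move=> sa; rewrite -[a]cats0; apply: lift; rewrite cats0.
have u_even : ~~ odd (count odd a).
  suff -> : odd (count odd a) = odd (sumn a) by [].
  by elim: (a) => //= x t IH; rewrite !oddD IH; case: (odd x).
apply: realizable_perm (base _ (count (predC odd) a) u_even).
apply/seq.permP => P /=; rewrite count_cat !count_nseq.
elim: a {sa u_even} => [|x a IH] /=; first by rewrite !muln0.
by rewrite -IH; case: (odd x) => /=; rewrite !mulnS; clear; lia.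
Qed.

(** Each square x is replaced by two neighbours 2x and 2x+1; the vertices between the two halves are
    regular. *)
Definition stretch s := flatten [seq [:: x.*2; x.*2.+1] | x <- s].

Lemma one_row_stretch s cs : one_row s cs ->
  one_row (stretch s)
    ([seq [seq x.*2 | x <- c] | c <- cs] ++ [seq [:: x.*2.+1] | x <- s]).
Proof.
move=> os; have [ps ls fs hc] := os; have us := one_row_uniq os.
have size_st t : size (stretch t) = (size t).*2.
  by elim: t => [|x t IH] //=; rewrite IH doubleS.
have mem_st t j : (j \in stretch t) = (j./2 \in t).
  elim: t => [|x t IH] //=; rewrite !inE IH orbA; congr (_ || _).
  by apply/idP/idP; lia.
have turn_st p x t : s = p ++ x :: t ->
    turn (stretch s) x.*2 = (turn s x).*2 /\ turn (stretch s) x.*2.+1 = x.*2.+1.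
  move=> def_s; have xp : x \notin p.
    by move: us; rewrite def_s uniq_catC /= mem_cat negb_or => /andP[/andP[]].
  have -> : stretch s = stretch p ++ x.*2 :: x.*2.+1 :: stretch t.
    by rewrite def_s /stretch map_cat flatten_cat.
  split; last first.
    rewrite -cat_rcons turn_cat ?map_rcons ?last_rcons //.
    by rewrite mem_rcons inE mem_st negb_or; apply/andP; split; [lia|];
      have -> : (x.*2.+1)./2 = x by lia.
  rewrite turn_cat ?mem_st ?doubleK // def_s turn_cat //.
  case/lastP: p {def_s xp} => [//|p y].
  by rewrite /stretch !map_rcons -cats1 flatten_cat /= map_cat last_cat last_rcons /= doubleS.
split.
- apply: uniq_perm; [|exact: iota_uniq|move=> j]; last first.
    by rewrite mem_st (one_row_mem _ os) mem_iota size_st; apply/idP/idP; lia.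
  rewrite /stretch; elim: s us {os ps ls fs hc turn_st} => [//|x s IH] /= /andP[xs us].
  have e : (x.*2.+1)./2 = x by clear; lia.
  by rewrite inE -/(stretch s) !mem_st IH // doubleK e (negbTE xs) orbF ltn_eqF.
- rewrite size_st -ls; case/lastP: (s) => [//|p y].
  by rewrite /stretch !map_rcons -cats1 flatten_cat /= map_cat last_cat last_rcons /= doubleS.
- have h : perm_eq (stretch s) ([seq x.*2 | x <- s] ++ [seq x.*2.+1 | x <- s]).
    elim: (s) => [//|x t IH]; apply/seq.permP => P; move/seq.permP/(_ P): IH.
    rewrite !count_cat /= -/(stretch t) => ->.
    by move: (P x.*2 : nat) (P x.*2.+1 : nat); clear; lia.
  rewrite perm_sym; apply: perm_trans h _.
  rewrite flatten_cat -map_flatten flatten_map1 perm_cat //.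
  by apply: perm_map; rewrite perm_sym.
move=> c; rewrite mem_cat => /orP [] /mapP [d ds ->].
  rewrite -map_rot -(hc d ds) -!map_comp; apply/eq_in_map => x xd /=.
  have [p [t def_s]] : exists p t, s = p ++ x :: t.
    by case/splitPr: (cycle_mem os ds xd) => p t; exists p, t.
  by have [] := turn_st _ _ _ def_s.
have [p [t def_s]] : exists p t, s = p ++ d :: t.
  by case/splitPr: ds => p t; exists p, t.
by have [_ e] := turn_st _ _ _ def_s; rewrite /= e.
Qed.

End OneRow.

(** * Vertices and cone points *)

Import Order.TTheory GRing.Theory Num.Theory.

Section Vertices.

Variables (R : realType) (n : nat).
Implicit Types (O : square_tiled n) (c : corner n) (p q : point R n) (i j : 'I_n).

(* The square whose lower left corner is glued to the corner [c], reached by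
   going right first; going up first may lead to another one, next to it around
   the vertex. *)
Definition lower_left O c : 'I_n :=
  let i := if c.2.1 then sts_right O c.1 else c.1 in
  if c.2.2 then sts_up O i else i.

(** Going down, left, up and right turns once around the lower left corner of a square, so an orbit
    of length k is a vertex of angle 2 k pi. *)
Definition around O : {perm 'I_n} :=
  ((sts_up O)^-1 * (sts_right O)^-1 * sts_up O * sts_right O)%g.

Definition singular O : {set 'I_n} := [set j | 1 < #|porbit (around O) j|].

(** This test treats the four corners of a square alike, so that its behaviour under swap and
    reflection is immediate. *)
Definition singular_corner O c : bool :=
  let h := if c.2.1 then sts_right O else (sts_right O)^-1%g in
  let v := if c.2.2 then sts_up O else (sts_up O)^-1%g in
  h (v c.1) != v (h c.1).

Lemma aroundE O i : around O (sts_up O (sts_right O i)) = sts_right O (sts_up O i).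
Proof. by rewrite /around !permM !permK. Qed.

Lemma card_porbit_gt1 (T : finType) (s : {perm T}) x :
  (1 < #|porbit s x|) = (s x != x).
Proof.
have [sx|sx] := eqVneq (s x) x.
  suff -> : porbit s x = [set x] by rewrite cards1.
  apply/setP => y; rewrite inE; apply/idP/eqP => [/porbitP [k ->]|->].
    by rewrite permX iter_fix.
  exact: porbit_id.
have <- : #|[set x; s x]| = 2 by rewrite cards2 eq_sym sx.
apply: subset_leq_card; apply/subsetP => y; rewrite !inE => /orP [] /eqP ->.
  exact: porbit_id.
by have := mem_porbit s 1 x; rewrite expg1.
Qed.

Lemma singularE O j : (j \in singular O) = (around O j != j).
Proof. by rewrite inE card_porbit_gt1. Qed.

Lemma singular_cornerE O c : singular_corner O c = (lower_left O c \in singular O).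
Proof.
rewrite singularE /singular_corner /lower_left /around !permM.
case: c => i [[] []] /=; set h := sts_right O; set v := sts_up O.
- by rewrite !permK.
- by rewrite (inj_eq perm_inj) -[in RHS](inj_eq (@perm_inj _ v^-1%g)) permK
    -[in RHS](inj_eq (@perm_inj _ h)) permKV eq_sym.
- by rewrite permK -[in LHS](inj_eq (@perm_inj _ h)) permKV eq_sym.
by rewrite -[in RHS](inj_eq (@perm_inj _ h^-1%g)) permK
  -[in RHS](inj_eq (@perm_inj _ v^-1%g)) permK.
Qed.

Lemma porbit_around_mem O i j : (around O i \in porbit (around O) j) = (i \in porbit (around O) j).
Proof. by rewrite -!eq_porbit_mem; have := porbit_perm (around O) 1 i; rewrite expg1 => ->. Qed.

(** An invariant of the gluings: it shows that [same_point] identifies no more corners than the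
    orbits of [around] do. *)
Definition at_vertex O j p :=
  exists2 c, p = corner_point R c & lower_left O c \in porbit (around O) j.

Lemma natb_eq1 (b : bool) : (1 : R)%R = (b%:R)%R -> b.
Proof. by case: b => // /eqP; rewrite oner_eq0. Qed.

Lemma natb_eq0 (b : bool) : (0 : R)%R = (b%:R)%R -> ~~ b.
Proof. by case: b => // /eqP; rewrite eq_sym oner_eq0. Qed.

Lemma side_glued_vertex O j p q : side_glued O p q -> at_vertex O j p <-> at_vertex O j q.
Proof.
case=> [i y _|i x _]; split.
- case=> -[i' [a b]] [-> /natb_eq1 /= -> ->] h.
  by exists (sts_right O i', (false, b)).
- case=> -[i' [a b]] [<- /natb_eq0 /= /negbTE -> ->] h.
  by exists (i, (true, b)).
- case=> -[i' [a b]] [-> -> /natb_eq1 /= ->] h.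
  exists (sts_up O i', (a, false)) => //; move: h; rewrite /lower_left /=.
  by case: a => //; rewrite -porbit_around_mem aroundE.
case=> -[i' [a b]] [<- -> /natb_eq0 /= /negbTE ->] h.
exists (i, (a, true)) => //; move: h; rewrite /lower_left /=.
by case: a => //; rewrite -aroundE porbit_around_mem.
Qed.

Lemma same_point_vertex O j p q : same_point O p q -> at_vertex O j p <-> at_vertex O j q.
Proof.
elim=> [p' q' /side_glued_vertex //|//|p' q' _ [h1 h2]|p' q' r' _ [h1 h2] _ [h3 h4]].
- by split.
- by split=> [/h1/h3|/h4/h2].
Qed.

Lemma unit_interval_natb (b : bool) : (0 <= (b%:R : R) <= 1)%R.
Proof. by case: b; rewrite ?lexx ?ler01. Qed.

Lemma corner_lower_left O c :
  same_point O (corner_point R c) (corner_point R (lower_left O c, (false, false))).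
Proof.
case: c => i [a b]; rewrite /lower_left /corner_point /=.
apply: (@rst_trans _ _ _ (if a then sts_right O i else i, (0, (b%:R)))%R).
  by case: a; [apply: rst_step; apply: glued_right; apply: unit_interval_natb | exact: rst_refl].
by case: b; [apply: rst_step; apply: glued_up; apply: (unit_interval_natb false) | exact: rst_refl].
Qed.

Lemma corner_around O j : same_point O (corner_point R (j, (false, false)))
  (corner_point R (around O j, (false, false))).
Proof.
have [i ->] : exists i, j = sts_up O (sts_right O i).
  by exists ((sts_right O)^-1 ((sts_up O)^-1 j))%g; rewrite !permKV.
rewrite aroundE.
apply: rst_trans (rst_sym _ _ _ _ (corner_lower_left O (i, (true, true)))) _.
apply: (@rst_trans _ _ _ (corner_point R (sts_up O i, (true, false)))).
  by apply: rst_step; apply: glued_up; apply: (unit_interval_natb true).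
exact: (corner_lower_left O (sts_up O i, (true, false))).
Qed.

Lemma corner_point_inj : injective (@corner_point R n).
Proof.
move=> [i [a b]] [i2 [a2 b2]] [/= -> ha hb]; congr (_, (_, _)); [move: ha | move: hb].
  by case: a a2 => [] [] // /eqP; rewrite ?oner_eq0 // eq_sym oner_eq0.
by case: b b2 => [] [] // /eqP; rewrite ?oner_eq0 // eq_sym oner_eq0.
Qed.

Lemma same_corner O c c' : same_point O (corner_point R c) (corner_point R c') <->
  porbit (around O) (lower_left O c) = porbit (around O) (lower_left O c').
Proof.
split=> [h|e].
  have : at_vertex O (lower_left O c) (corner_point R c').
    by rewrite -(same_point_vertex _ h); exists c => //; apply: porbit_id.
  case=> c2 h1 h2; apply/esym/eqP; rewrite eq_porbit_mem.
  by rewrite (corner_point_inj h1).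
have: lower_left O c' \in porbit (around O) (lower_left O c) by rewrite e porbit_id.
case/porbitP => k ek.
apply: rst_trans (corner_lower_left O c) _.
apply: rst_trans (rst_sym _ _ _ _ (corner_lower_left O c')); rewrite ek.
elim: k {ek} => [|k IH]; first by rewrite expg0 perm1; apply: rst_refl.
by apply: rst_trans IH _; rewrite expgSr permM; apply: corner_around.
Qed.

Lemma vertex_ofE O c : vertex_of R O c =
  [set c' | porbit (around O) (lower_left O c') == porbit (around O) (lower_left O c)].
Proof.
apply/setP => c'; rewrite !inE; apply/asboolP/eqP.
  by move/same_corner.
by move=> e; apply/same_corner.
Qed.

(** For each of the four positions in the square, [lower_left] is a bijection from corners to
    squares. *)
Lemma card_corners O (A : {set 'I_n}) : #|[set c | lower_left O c \in A]| = 4 * #|A|.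
Proof.
pose f c : corner n := (lower_left O c, c.2).
have finj : injective f.
  move=> [i [a b]] [i' [a' b']] [e ea eb]; rewrite -{}ea -{}eb in e *.
  by congr (_, _); move: e; rewrite /lower_left /=; case: a; case: b; do ?move/perm_inj.
have -> : [set c | lower_left O c \in A] = f @^-1: setX A setT.
  by apply/setP => c; rewrite !inE andbT.
by rewrite card_preimset // cardsX cardsT card_prod card_bool mulnC.
Qed.

Lemma card_vertex O c : #|vertex_of R O c| = 4 * #|porbit (around O) (lower_left O c)|.
Proof.
rewrite vertex_ofE -(card_corners O); apply: eq_card => c'; rewrite !inE.
by rewrite eq_porbit_mem.
Qed.

Lemma cone_vertexP O c : (vertex_of R O c \in cone_points R O) = singular_corner O c.
Proof.
rewrite inE card_vertex singular_cornerE inE imset_f //=.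
by lia.
Qed.

Lemma is_cone_pointP O p :
  is_cone_point O p <-> exists2 c, p = corner_point R c & singular_corner O c.
Proof.
split=> [[c pc]|[c -> sc]]; last first.
  by exists c; [exact: rst_refl | rewrite cone_vertexP].
rewrite cone_vertexP singular_cornerE inE => h.
have : at_vertex O (lower_left O c) p.
  by rewrite (same_point_vertex _ pc); exists c => //; apply: porbit_id.
case=> c' -> h'; exists c' => //; rewrite singular_cornerE inE.
by move: h'; rewrite -eq_porbit_mem => /eqP ->.
Qed.

Lemma cone_points_partition O : partition (cone_points R O)
  [set c | lower_left O c \in singular O].
Proof.
set D := [set c | _].
have -> : cone_points R O =
    preim_partition (fun c => porbit (around O) (lower_left O c)) D.
  have vE c : c \in D -> vertex_of R O c =
      [set y in D | porbit (around O) (lower_left O c) == porbit (around O) (lower_left O y)].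
    rewrite inE vertex_ofE => cD; apply/setP => y; rewrite !inE eq_sym.
    by case: eqP => [e|]; rewrite ?andbF //; move: cD; rewrite inE e => ->.
  apply/setP => V; apply/idP/imsetP => [|[c cD ->]].
    rewrite inE => /andP[/imsetP [c _ ->] h]; exists c.
      by rewrite inE -singular_cornerE -cone_vertexP inE h andbT imset_f.
    by rewrite vE // inE -singular_cornerE -cone_vertexP inE h andbT imset_f.
  by rewrite -vE // cone_vertexP singular_cornerE; move: cD; rewrite inE.
exact: preim_partitionP.
Qed.

(** The cone points partition the corners with singular [lower_left]; both sides count these
    corners, up to the factor 4. *)
Lemma card_singular O (alpha : seq nat) : in_stratum R O alpha ->
  #|singular O| = sumn (map succn alpha).
Proof.
move=> h; have := perm_sumn h.
have -> : sumn [seq #|(V : {set corner n})| | V in cone_points R O] = 4 * #|singular O|.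
  by rewrite -(card_corners O) (card_partition (cone_points_partition O)) sumnE big_map big_enum.
have -> : sumn [seq 4 * a.+1 | a <- alpha] = 4 * sumn (map succn alpha).
  by elim: (alpha) => //= a t ->; rewrite mulnDr.
by move/eqP; rewrite eqn_pmul2l // => /eqP.
Qed.

End Vertices.

(** * The action of the modular group on holonomy *)

Lemma square_tiled_eq n (O O' : square_tiled n) :
  sts_right O = sts_right O' -> sts_up O = sts_up O' -> O = O'.
Proof.
case: O O' => [r u ne co] [r' u' ne' co'] /= er eu.
case: _ / er in co' *; case: _ / eu in co' *.
by rewrite (bool_irrelevance ne ne') (Prop_irrelevance co co').
Qed.

Section Transport.

Variables (R : realType) (n : nat).
Implicit Types (O : square_tiled n) (p q : point R n) (z v : R * R).
Local Open Scope ring_scope.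

Lemma same_point_refl O p : same_point O p p.
Proof. exact: rst_refl. Qed.

Lemma same_point_sym O p q : same_point O p q -> same_point O q p.
Proof. exact: rst_sym. Qed.

Lemma same_point_trans O p q r :
  same_point O p q -> same_point O q r -> same_point O p r.
Proof. exact: rst_trans. Qed.

Lemma same_point_cone O p q : same_point O p q -> is_cone_point O p -> is_cone_point O q.
Proof.
by move=> pq [c pc sc]; exists c => //; apply: same_point_trans pc; apply: same_point_sym.
Qed.

Lemma geodesic_in_square O v p t q : geodesic O v p t q -> in_square p.2 /\ in_square q.2.
Proof. by elim=> [//|p1 q1 q2 r1 t1 t2 _ [? _] _ _ _ [_ ?]]. Qed.

(** * Transfer of saddle connections along a map of surfaces *)

Section Map.

Variables (O O' : square_tiled n) (f : point R n -> point R n) (g : R * R -> R * R).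
Hypothesis f_glued : forall p q, side_glued O p q -> same_point O' (f p) (f q).
Hypothesis f_cone : forall p, is_cone_point O p -> is_cone_point O' (f p).
Hypothesis f_regular : forall p, in_square p.2 -> is_cone_point O' (f p) -> is_cone_point O p.
Hypothesis f_segment : forall i z z' t v, 0 < t -> in_square z -> in_square z' ->
  z' = (z.1 + t * v.1, z.2 + t * v.2) ->
  exists p q, [/\ same_point O' p (f (i, z)), same_point O' q (f (i, z')) &
    geodesic O' (g v) p t q].
Hypothesis g_nonzero : forall v, g v = (0, 0) -> v = (0, 0).

Lemma map_same_point p q : same_point O p q -> same_point O' (f p) (f q).
Proof.
elim=> [p1 q1 /f_glued //|p1|p1 q1 _|p1 q1 r1 _ h1 _ h2].
- exact: same_point_refl.
- exact: same_point_sym.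
- exact: same_point_trans h1 h2.
Qed.

(** Images of consecutive pieces are joined through [same_point], because [f_segment] fixes their
    ends only up to gluing; [f_regular] keeps the junctions regular. *)
Lemma map_geodesic v p t q : geodesic O v p t q -> exists p' q',
  [/\ same_point O' p' (f p), same_point O' q' (f q) & geodesic O' (g v) p' t q'].
Proof.
elim=> [i z z' t' t0 zs zs' e|p1 q1 q2 r1 t1 t2 h1 [p' [q' [pp qq pq]]] q12 nc _ [p'' [q'' [pp' qq' pq']]]].
  exact: f_segment e.
exists p', q''; split=> //; apply: geodesic_cat pq _ _ pq'.
  apply: same_point_trans qq _; apply: same_point_trans (map_same_point q12) _.
  exact: same_point_sym.
move=> /(same_point_cone qq) /f_regular h; apply: nc; apply: h.
by have [] := geodesic_in_square h1.
Qed.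

Lemma map_Hol v : Hol R O v -> Hol R O' (g v).
Proof.
case=> v0 [p [q [pc qc /map_geodesic [p' [q' [pp qq pq]]]]]].
split; first by move/g_nonzero.
exists p', q'; split=> //; [move: pp | move: qq] => /same_point_sym h;
  by apply: same_point_cone h _; apply: f_cone.
Qed.

End Map.

Lemma connect_transfer (r u r' u' : {perm 'I_n}) :
  (forall i, connect (share_side r' u') i (r i)) ->
  (forall i, connect (share_side r' u') i (u i)) ->
  (forall i j, connect (share_side r u) i j) ->
  forall i j, connect (share_side r' u') i j.
Proof.
move=> hr hu h i j; have sym : connect_sym (share_side r' u').
  apply: sym_connect_sym => x y; rewrite /share_side /=.
  by apply/idP/idP; case/or4P=> ->; rewrite ?orbT.
apply: (connect_sub (e := share_side r u)) (h i j) => x y /or4P [] /eqP ->.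
- exact: hr.
- by rewrite sym.
- exact: hu.
- by rewrite sym.
Qed.

Lemma swap_connected O i j : connect (share_side (sts_up O) (sts_right O)) i j.
Proof.
apply: connect_transfer (sts_connected O) _ _ => k; apply: connect1;
  by rewrite /share_side /= eqxx ?orbT.
Qed.

Definition swap O : square_tiled n := SquareTiled (sts_nonempty O) (swap_connected O).

Lemma reflect_connected O i j : connect (share_side (sts_right O)^-1 (sts_up O)) i j.
Proof.
apply: connect_transfer (sts_connected O) _ _ => k; apply: connect1;
  by rewrite /share_side /= ?permK eqxx ?orbT.
Qed.

Definition reflect O : square_tiled n := SquareTiled (sts_nonempty O) (reflect_connected O).

Lemma shear_connected O i j :
  connect (share_side (sts_right O) ((sts_right O)^-1 * sts_up O)) i j.
Proof.
apply: connect_transfer (sts_connected O) _ _ => k.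
  by apply: connect1; rewrite /share_side /= eqxx.
apply: (@connect_trans _ _ (sts_right O k)); apply: connect1.
  by rewrite /share_side /= eqxx.
by rewrite /share_side /= permM permK eqxx !orbT.
Qed.

(* The shear (x, y) -> (x + y, y) makes a parallelogram of every square; the part
   of it beyond the right side belongs to the next square of the new tiling. *)
Definition shear O : square_tiled n := SquareTiled (sts_nonempty O) (shear_connected O).

Lemma singular_corner_lower_left O i :
  (i \in singular O) = singular_corner O (i, (false, false)).
Proof. by rewrite singular_cornerE. Qed.

Lemma swap_singular_corner O i a b :
  singular_corner (swap O) (i, (b, a)) = singular_corner O (i, (a, b)).
Proof. by rewrite /singular_corner /= eq_sym. Qed.

Lemma swap_singular O : singular (swap O) = singular O.
Proof. by apply/setP => i; rewrite !singular_corner_lower_left swap_singular_corner. Qed.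

Lemma reflect_singular_corner O i a b :
  singular_corner (reflect O) (i, (~~ a, b)) = singular_corner O (i, (a, b)).
Proof. by case: a; rewrite /singular_corner /= ?invgK. Qed.

(** Reflection exchanges lower left and lower right corners, so the singular set is not kept but
    pulled back by [sts_right O]. *)
Lemma card_reflect_singular O : #|singular (reflect O)| = #|singular O|.
Proof.
rewrite -(card_preimset (singular O) (@perm_inj _ (sts_right O))).
apply: eq_card => i; rewrite [RHS]inE singular_corner_lower_left.
by rewrite (reflect_singular_corner O i true false) singular_cornerE.
Qed.

Lemma shear_around O : around (shear O) = around O.
Proof.
by apply/permP => j; rewrite /around /= invMg invgK !permM permK.
Qed.

Lemma shear_singular O : singular (shear O) = singular O.
Proof. by apply/setP => j; rewrite !singularE shear_around. Qed.

Definition swap_point p : point R n := (p.1, (p.2.2, p.2.1)).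

Lemma swap_pointK : involutive swap_point.
Proof. by case=> i [x y]. Qed.

Lemma swap_Hol O v : Hol R O v -> Hol R (swap O) (v.2, v.1).
Proof.
pose g v : R * R := (v.2, v.1).
apply: (@map_Hol O (swap O) swap_point g).
- move=> p q []; move=> i x xs; apply: rst_step; [exact: (@glued_up _ _ (swap O))|].
  exact: (@glued_right _ _ (swap O)).
- move=> p /is_cone_pointP [[i [a b]] -> sc]; apply/is_cone_pointP.
  by exists (i, (b, a)); rewrite ?swap_singular_corner.
- move=> p _ /is_cone_pointP [[i [a b]] e sc]; apply/is_cone_pointP.
  exists (i, (b, a)); last by rewrite -swap_singular_corner.
  by rewrite -[p]swap_pointK e.
- move=> i z z' t w t0 zs zs' e; exists (swap_point (i, z)), (swap_point (i, z')).
  split; [exact: same_point_refl..|]; apply: geodesic_segment => //.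
  + by move: zs; rewrite /in_square andbC.
  + by move: zs'; rewrite /in_square andbC.
  + by rewrite e.
- by move=> [a b] [-> ->].
Qed.

Definition reflect_point p : point R n := (p.1, (1 - p.2.1, p.2.2)).

Lemma reflect_pointK : involutive reflect_point.
Proof. by case=> i [x y]; rewrite /reflect_point /= subKr. Qed.

Lemma reflect_corner_point i a b :
  reflect_point (corner_point R (i, (a, b))) = corner_point R (i, (~~ a, b)).
Proof. by case: a; rewrite /reflect_point /corner_point /= ?subrr ?subr0. Qed.

Lemma reflect_in_square z : in_square z -> in_square (1 - z.1, z.2).
Proof. by rewrite /in_square /= => /andP[/andP[? ?] ->]; rewrite andbT; lra. Qed.

Lemma reflect_Hol O v : Hol R O v -> Hol R (reflect O) (- v.1, v.2).
Proof.
pose g v : R * R := (- v.1, v.2).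
apply: (@map_Hol O (reflect O) reflect_point g).
- move=> p q []; move=> i x xs; rewrite /reflect_point /=.
    apply: rst_sym; rewrite subrr subr0 -{2}(permK (sts_right O) i).
    exact: (rst_step _ _ _ _ (@glued_right _ _ (reflect O) _ _ xs)).
  apply: rst_step; apply: (@glued_up _ _ (reflect O)).
  by move: xs => /andP[? ?]; apply/andP; split; lra.
- move=> p /is_cone_pointP [[i [a b]] -> sc]; apply/is_cone_pointP.
  by exists (i, (~~ a, b)); rewrite ?reflect_singular_corner // reflect_corner_point.
- move=> p _ /is_cone_pointP [[i [a b]] e sc]; apply/is_cone_pointP.
  exists (i, (~~ a, b)); last by rewrite -reflect_singular_corner negbK.
  by rewrite -reflect_corner_point -e reflect_pointK.
- move=> i z z' t w t0 zs zs' e; exists (reflect_point (i, z)), (reflect_point (i, z')).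
  split; [exact: same_point_refl..|]; apply: geodesic_segment => //.
  + exact: reflect_in_square.
  + exact: reflect_in_square.
  + by rewrite e /=; congr (_, _); ring.
- by move=> [a b] [/eqP]; rewrite oppr_eq0 => /eqP /= -> ->.
Qed.

Definition shear_point O p : point R n :=
  if p.2.1 + p.2.2 <= 1 then (p.1, (p.2.1 + p.2.2, p.2.2))
  else (sts_right O p.1, (p.2.1 + p.2.2 - 1, p.2.2)).

Definition shear_corner O (c : corner n) : corner n :=
  if c.2.1 && c.2.2 then (sts_right O c.1, (true, true)) else (c.1, (c.2.1 || c.2.2, c.2.2)).

Lemma shear_corner_point O c :
  shear_point O (corner_point R c) = corner_point R (shear_corner O c).
Proof.
case: c => i [[] []]; rewrite /shear_point /shear_corner /corner_point /= ?addr0 ?add0r ?lexx //.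
  by rewrite addrK ifF //; apply/negbTE; rewrite -ltNge; lra.
by rewrite ler01.
Qed.

Lemma shear_corner_singular O c :
  singular_corner (shear O) (shear_corner O c) = singular_corner O c.
Proof.
rewrite !singular_cornerE shear_singular.
suff -> : lower_left (shear O) (shear_corner O c) = lower_left O c by [].
by case: c => i [[] []]; rewrite /shear_corner /lower_left /= ?permM ?permK.
Qed.

Lemma shear_point_left O i z : z.1 + z.2 <= 1 ->
  same_point (shear O) (i, (z.1 + z.2, z.2)) (shear_point O (i, z)).
Proof. by move=> h; rewrite /shear_point /= h; apply: same_point_refl. Qed.

Lemma shear_point_right O i z : in_square z -> 1 <= z.1 + z.2 ->
  same_point (shear O) (sts_right O i, (z.1 + z.2 - 1, z.2)) (shear_point O (i, z)).
Proof.
move=> /andP[_ z2] h; rewrite /shear_point /=.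
case: ifP => h'; last exact: same_point_refl.
have -> : z.1 + z.2 = 1 by lra.
by rewrite subrr; apply: rst_sym; apply: rst_step; apply: (@glued_right _ _ (shear O)).
Qed.

Lemma shear_glued O p q : side_glued O p q ->
  same_point (shear O) (shear_point O p) (shear_point O q).
Proof.
case=> i x x01; have /andP[x0 x1] := x01.
  have h1 : in_square ((1, x) : R * R) by rewrite /in_square /= ler01 lexx x0 x1.
  apply: same_point_trans (same_point_sym (shear_point_right O i h1 _)) _ => /=; first by lra.
  apply: same_point_trans (@shear_point_left O (sts_right O i) (0, x) _) => /=; last by lra.
  by rewrite add0r addrC addKr; apply: same_point_refl.
have h1 : in_square ((x, 1) : R * R) by rewrite /in_square /= ler01 lexx x0 x1.
apply: same_point_trans (same_point_sym (shear_point_right O i h1 _)) _ => /=; first by lra.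
apply: same_point_trans (@shear_point_left O (sts_up O i) (x, 0) _) => /=; last by lra.
rewrite addr0 addrK.
have -> : sts_up O i = sts_up (shear O) (sts_right O i) by rewrite permM permK.
by apply: rst_step; apply: glued_up.
Qed.

Lemma shear_regular O p : in_square p.2 ->
  is_cone_point (shear O) (shear_point O p) -> is_cone_point O p.
Proof.
case: p => i [x y] /andP[/= /andP[x0 x1] /andP[y0 y1]] /is_cone_pointP [c e sc].
have [c' def_p] : exists c', (i, (x, y)) = corner_point R c'.
  case: c e {sc} => j [a b]; rewrite /shear_point /=; case: ifP => h [_ ex ey].
    exists (i, (a && ~~ b, b)); rewrite /corner_point /= -ey; congr (_, (_, _)).
    by case: b ey => /= ey; [rewrite andbF /= | rewrite andbT -ex]; lra.
  exists (i, (a, b)); rewrite /corner_point /= -ey -ex; congr (_, (_, _)).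
  by case: b ey => /= ey; lra.
rewrite def_p; apply/is_cone_pointP; exists c' => //.
by rewrite -shear_corner_singular; move: e; rewrite def_p shear_corner_point => /corner_point_inj ->.
Qed.

(* The crossing point is not a corner since the corners are extreme points. *)
Lemma diagonal_crossing (x y x' y' : R) : 0 <= x -> 0 <= y -> x' <= 1 -> y' <= 1 ->
  x + y < 1 -> 1 < x' + y' -> y <= 1 -> 0 <= y' ->
  exists l, [/\ 0 < l < 1, (1 - l) * (x + y) + l * (x' + y') = 1 &
    0 < (1 - l) * y + l * y' < 1].
Proof.
move=> x0 y0 x1 y1 s1 s1' yl yl'.
have d0 : 0 < (x' + y') - (x + y) by lra.
have dn : (x' + y') - (x + y) != 0 by rewrite gt_eqF.
exists ((1 - (x + y)) / ((x' + y') - (x + y))).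
set l := _ / _; have l0 : 0 < l by rewrite divr_gt0 //; lra.
have l1 : l < 1 by rewrite ltr_pdivrMr //; lra.
split; first by rewrite l0.
  by rewrite /l; field.
by apply/andP; split; nra.
Qed.

Lemma regular_side_point O i (y : R) : 0 < y < 1 ->
  ~ is_cone_point O (i, (1, y) : R * R) /\ ~ is_cone_point O (i, (0, y) : R * R).
Proof.
move=> /andP[y0 y1].
by split=> /is_cone_pointP [[j [a []]] [_ _ /= ey] _]; move: y0 y1; rewrite ey ltxx.
Qed.

(** A segment that stays on one side of the diagonal x + y = 1 is sheared within one square; one
    that crosses it is cut there, and its two parts lie in adjacent squares of the new tiling. *)
Lemma shear_segment O i z z' t v : 0 < t -> in_square z -> in_square z' ->
  z' = (z.1 + t * v.1, z.2 + t * v.2) ->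
  exists p q, [/\ same_point (shear O) p (shear_point O (i, z)),
    same_point (shear O) q (shear_point O (i, z')) &
    geodesic (shear O) (v.1 + v.2, v.2) p t q].
Proof.
move=> t0 zs zs' e.
have left w : in_square w -> w.1 + w.2 <= 1 -> in_square (w.1 + w.2, w.2).
  by move=> /andP[/andP[? ?] /andP[? ?]] ?; rewrite /in_square /=; lra.
have right w : in_square w -> 1 <= w.1 + w.2 -> in_square (w.1 + w.2 - 1, w.2).
  by move=> /andP[/andP[? ?] /andP[? ?]] ?; rewrite /in_square /=; lra.
have [/andP[/andP[x0 x1] /andP[y0 y1]] /andP[/andP[x0' x1'] /andP[y0' y1']]] := (zs, zs').
have le_le : z.1 + z.2 <= 1 -> z'.1 + z'.2 <= 1 -> geodesic (shear O) (v.1 + v.2, v.2)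
    (i, (z.1 + z.2, z.2)) t (i, (z'.1 + z'.2, z'.2)).
  move=> s1 s1'; apply: geodesic_segment; rewrite ?left //.
  by rewrite e /=; congr (_, _); ring.
have ge_ge : 1 <= z.1 + z.2 -> 1 <= z'.1 + z'.2 -> geodesic (shear O) (v.1 + v.2, v.2)
    (sts_right O i, (z.1 + z.2 - 1, z.2)) t (sts_right O i, (z'.1 + z'.2 - 1, z'.2)).
  move=> s1 s1'; apply: geodesic_segment; rewrite ?right //.
  by rewrite e /=; congr (_, _); ring.
have e1 : z'.1 = z.1 + t * v.1 by rewrite e.
have e2 : z'.2 = z.2 + t * v.2 by rewrite e.
have in_side (c a : R) : 0 < c < 1 -> 0 <= a <= 1 -> in_square (a, c).
  by rewrite /in_square /=; lra.
have [s1|s1|s1] := ltgtP (z.1 + z.2) 1; last first.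
- have [s1'|s1'] := lerP (z'.1 + z'.2) 1.
    exists (i, (z.1 + z.2, z.2)), (i, (z'.1 + z'.2, z'.2)).
    by split; [apply: shear_point_left..|apply: le_le] => //; lra.
  exists (sts_right O i, (z.1 + z.2 - 1, z.2)), (sts_right O i, (z'.1 + z'.2 - 1, z'.2)).
  by split; [apply: shear_point_right..|apply: ge_ge] => //; lra.
- have [s1'|s1'] := lerP 1 (z'.1 + z'.2).
    exists (sts_right O i, (z.1 + z.2 - 1, z.2)), (sts_right O i, (z'.1 + z'.2 - 1, z'.2)).
    by split; [apply: shear_point_right..|apply: ge_ge] => //; lra.
  exists (sts_right O i, (z.1 + z.2 - 1, z.2)), (i, (z'.1 + z'.2, z'.2)).
  split; [by apply: shear_point_right => //; lra|by apply: shear_point_left => //; lra|].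
  have [l [/andP[l0 l1] l_eq c01]] := diagonal_crossing x0' y0' x1 y1 s1' s1 y1' y0.
  set c := (1 - l) * z'.2 + l * z.2 in c01.
  have -> : t = (1 - l) * t + l * t by ring.
  apply: (@geodesic_cat _ _ _ _ _ (sts_right O i, (0, c)) (i, (1, c))).
  + apply: geodesic_segment; [by apply: mulr_gt0; lra|by apply: right => //; lra| |].
      by apply: in_side => //; lra.
    by rewrite /c /=; congr (_, _); rewrite e1 e2 in l_eq *; lra.
  + apply: rst_sym; apply: rst_step; apply: (@glued_right _ _ (shear O)); lra.
  + by have [] := regular_side_point (shear O) (sts_right O i) c01.
  apply: geodesic_segment; [by apply: mulr_gt0| |by apply: left => //; lra|].
    by apply: in_side => //; lra.
  by rewrite /c /=; congr (_, _); rewrite e1 e2 in l_eq *; lra.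
have [s1'|s1'] := lerP (z'.1 + z'.2) 1.
  exists (i, (z.1 + z.2, z.2)), (i, (z'.1 + z'.2, z'.2)).
  by split; [apply: shear_point_left..|apply: le_le] => //; lra.
exists (i, (z.1 + z.2, z.2)), (sts_right O i, (z'.1 + z'.2 - 1, z'.2)).
split; [by apply: shear_point_left => //; lra|by apply: shear_point_right => //; lra|].
have [l [/andP[l0 l1] l_eq c01]] := diagonal_crossing x0 y0 x1' y1' s1 s1' y1 y0'.
set c := (1 - l) * z.2 + l * z'.2 in c01.
have -> : t = l * t + (1 - l) * t by ring.
apply: (@geodesic_cat _ _ _ _ _ (i, (1, c)) (sts_right O i, (0, c))).
+ apply: geodesic_segment; [by apply: mulr_gt0|by apply: left => //; lra| |].
    by apply: in_side => //; lra.
  by rewrite /c /=; congr (_, _); rewrite e1 e2 in l_eq *; lra.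
+ apply: rst_step; apply: (@glued_right _ _ (shear O)); lra.
+ by have [] := regular_side_point (shear O) i c01.
apply: geodesic_segment; [by apply: mulr_gt0; lra| |by apply: right => //; lra|].
  by apply: in_side => //; lra.
by rewrite /c /=; congr (_, _); rewrite e1 e2 in l_eq *; lra.
Qed.

Lemma shear_Hol O v : Hol R O v -> Hol R (shear O) (v.1 + v.2, v.2).
Proof.
pose g v : R * R := (v.1 + v.2, v.2).
apply: (@map_Hol O (shear O) (shear_point O) g).
- exact: shear_glued.
- move=> p /is_cone_pointP [c -> sc]; apply/is_cone_pointP.
  by exists (shear_corner O c); rewrite ?shear_corner_singular // shear_corner_point.
- exact: shear_regular.
- exact: shear_segment.
- by move=> [a b] [] /= + b0; rewrite b0 addr0 => ->.
Qed.

Lemma swapK O : swap (swap O) = O.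
Proof. exact: square_tiled_eq. Qed.

Lemma reflectK O : reflect (reflect O) = O.
Proof. by apply: square_tiled_eq; rewrite //= invgK. Qed.

Definition unshear O := reflect (shear (reflect O)).

Lemma unshearK O : shear (unshear O) = O.
Proof. by apply: square_tiled_eq; rewrite //= ?invgK // mulgA mulVg mul1g. Qed.

Lemma unshear_Hol O v : Hol R O v -> Hol R (unshear O) (v.1 - v.2, v.2).
Proof.
move=> /reflect_Hol /shear_Hol /reflect_Hol /=.
by rewrite opprD opprK.
Qed.

Lemma swap_HolE O x y : Hol R (swap O) (x, y) <-> Hol R O (y, x).
Proof. by split=> /swap_Hol; rewrite ?swapK. Qed.

Lemma reflect_HolE O x y : Hol R (reflect O) (x, y) <-> Hol R O (- x, y).
Proof. by split=> /reflect_Hol; rewrite ?reflectK /= ?opprK. Qed.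

Lemma unshear_HolE O x y : Hol R (unshear O) (x, y) <-> Hol R O (x + y, y).
Proof.
split=> [/shear_Hol|/unshear_Hol]; rewrite ?unshearK //=.
by rewrite addrK.
Qed.

End Transport.

(** * Saddle connections *)

Section Saddles.

Variables (R : realType) (n : nat).
Implicit Types (O : square_tiled n) (p q : point R n) (v : R * R) (i j : 'I_n).
Local Open Scope ring_scope.

Lemma natb_eq1E (b : bool) : ((b%:R : R) == 1) = b.
Proof. by case: b; rewrite ?eqxx // eq_sym oner_eq0. Qed.

Lemma zero_eq1F : ((0 : R) == 1) = false.
Proof. exact: (natb_eq1E false). Qed.

Lemma singular_around O j : (around O j \in singular O) = (j \in singular O).
Proof. by rewrite !singularE (inj_eq perm_inj). Qed.

Lemma singular_up_right O j :
  (sts_right O (sts_up O j) \in singular O) = (sts_up O (sts_right O j) \in singular O).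
Proof. by rewrite -aroundE singular_around. Qed.

Lemma porbit_regular O i j :
  j \notin singular O -> i \in porbit (around O) j -> i = j.
Proof.
rewrite singularE negbK => /eqP e /porbitP [k ->].
by rewrite permX iter_fix.
Qed.

(* For a point on a horizontal side: the square lying above that side. *)
Definition above O p : 'I_n := if p.2.2 == 1 then sts_up O p.1 else p.1.

Definition on_horizontal p : bool := (p.2.2 == 0) || (p.2.2 == 1).

Lemma same_point_side O p q : same_point O p q -> 0 < p.2.1 < 1 -> on_horizontal p ->
  [/\ q.2.1 = p.2.1, on_horizontal q & above O q = above O p].
Proof.
move=> pq; set x := p.2.1 => x01 hp; set j := above O p.
pose inv p' := [/\ p'.2.1 = x, on_horizontal p' & above O p' = j].
suff h p1 q1 : same_point O p1 q1 -> inv p1 <-> inv q1.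
  by have [h1 _] := h _ _ pq; apply: h1.
elim=> [p2 q2|//|p2 q2 _ [h1 h2]|p2 q2 r2 _ [h1 h2] _ [h3 h4]].
- case=> [i y _|i y _]; rewrite /inv /on_horizontal /above /=.
    by split=> -[ex]; move: x01; rewrite -ex ltxx ?andbF.
  by rewrite !eqxx orbT zero_eq1F; split=> -[? _ ?].
- by split.
- by split=> [/h1/h3|/h4/h2].
Qed.

(** The path is followed through the square above it; [k] counts the vertices passed, which are
    regular since junctions are not cone points. *)
Lemma horizontal_geodesic O (d : R) p t q : 0 < d -> geodesic O (d, 0) p t q ->
  on_horizontal p ->
  [/\ p.2.1 < 1, 0 < q.2.1, on_horizontal q & exists k,
    [/\ q.2.1 + k%:R = p.2.1 + t * d, above O q = iter k (sts_right O) (above O p) &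
      forall l, (0 < l <= k)%N -> iter l (sts_right O) (above O p) \notin singular O]].
Proof.
move=> d0; elim=> [i z z' t1 t0 zs zs' e|p1 q1 q2 r1 t1 t2 g1 IH1 q12 nc g2 IH2] hp.
  have /andP[/andP[/= x0 x1] _] := zs; have /andP[/andP[/= x0' x1'] _] := zs'.
  have e1 : z'.1 = z.1 + t1 * d by rewrite e.
  have e2 : z'.2 = z.2 by rewrite e /= mulr0 addr0.
  have td : 0 < t1 * d by rewrite mulr_gt0.
  split => /=; [lra|lra|by rewrite /on_horizontal /= e2|].
  exists 0%N; split; [by rewrite addr0|by rewrite /above /= e2|by case].
have [x1 xq1 hq1 [k1 [ek1 ak1 sk1]]] := IH1 hp.
have [_ /andP[/andP[_ xq1'] _]] := geodesic_in_square g1.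
have iter_after k j l : (k < l)%N ->
    iter l (sts_right O) j = iter (l - k) (sts_right O) (iter k (sts_right O) j).
  by move=> kl; rewrite -iterD subnK // ltnW.
have [q1x|q1x] := eqVneq q1.2.1 1; last first.
  have xq : 0 < q1.2.1 < 1 by rewrite xq1 lt_neqAle q1x.
  have [ex hq2 aq2] := same_point_side q12 xq hq1.
  have [_ xr hr [k2 [ek2 ak2 sk2]]] := IH2 hq2.
  split => //; exists (k1 + k2)%N; split.
  - by rewrite natrD; rewrite ex in ek2; lra.
  - by rewrite ak2 aq2 ak1 addnC iterD.
  move=> l /andP[l0 lk]; have [lk1|lk1] := leqP l k1; first by apply: sk1; rewrite l0.
  rewrite (iter_after _ _ _ lk1) -ak1 -aq2; apply: sk2.
  by rewrite subn_gt0 lk1 leq_subLR.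
(* At an upper right corner, [lower_left] goes right then up, and [above] followed by a step right
   goes up then right; the results agree at a regular vertex. *)
have [c1 def_q1 hc1] : exists2 c, q1 = corner_point R c &
    c.2.1 && (lower_left O c == sts_right O (above O q1)) || (lower_left O c \in singular O).
  case: q1 q1x hq1 {IH1 IH2 g1 q12 nc xq1 ek1 ak1 xq1'} => i [x y] /= ->.
  rewrite /on_horizontal /above /= => /orP [] /eqP ->.
    by exists (i, (true, false)); rewrite // /lower_left /= zero_eq1F eqxx.
  exists (i, (true, true)); rewrite // /lower_left /= eqxx -aroundE singularE.
  by rewrite eq_sym; case: eqP.
have c1_regular : lower_left O c1 \notin singular O.
  by apply/negP => h; apply: nc; apply/is_cone_pointP; exists c1; rewrite ?singular_cornerE.
rewrite (negbTE c1_regular) orbF in hc1; have /andP[_ /eqP ac1] := hc1.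
have [c2 def_q2 /(porbit_regular c1_regular) c12] : at_vertex O (lower_left O c1) q2.
  by apply/(same_point_vertex _ q12); exists c1 => //; apply: porbit_id.
have hq2 : on_horizontal q2.
  by rewrite def_q2 /on_horizontal /=; case: (c2.2.2); rewrite ?eqxx ?orbT.
have [q2x xr hr [k2 [ek2 ak2 sk2]]] := IH2 hq2.
have c2l : c2.2.1 = false.
  by move: q2x; rewrite def_q2 /=; case: (c2.2.1); rewrite //= ltxx.
have q2x0 : q2.2.1 = 0 by rewrite def_q2 /= c2l.
have aq2 : above O q2 = iter k1.+1 (sts_right O) (above O p1).
  by rewrite iterS -ak1 -ac1 -c12 def_q2 /above /lower_left /= c2l natb_eq1E.
split => //; exists (k1 + k2)%N.+1; split.
- by rewrite -natr1 natrD; lra.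
- by rewrite ak2 aq2 -iterD addnS addnC.
move=> l /andP[l0 lk]; case: (ltngtP l k1.+1) => lk1.
- by apply: sk1; rewrite l0.
- by rewrite (iter_after _ _ _ lk1) -aq2; apply: sk2; rewrite subn_gt0 lk1 leq_subLR.
by rewrite lk1 iterS -ak1 -ac1.
Qed.

Definition row_saddle O d := exists i, [/\ i \in singular O,
  iter d (sts_right O) i \in singular O &
  forall l, (0 < l < d)%N -> iter l (sts_right O) i \notin singular O].

Lemma horizontal_saddle O (d : R) : 0 < d -> Hol R O (d, 0) ->
  exists k, d = k.+1%:R /\ row_saddle O k.+1.
Proof.
move=> d0 [_ [p [q [/is_cone_pointP [c -> sc] /is_cone_pointP [c' -> sc'] g]]]].
rewrite !singular_cornerE in sc sc'.
have hp : on_horizontal (corner_point R c).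
  by rewrite /on_horizontal /=; case: (c.2.2); rewrite ?eqxx ?orbT.
have [/= px qx hq [k [ek ak sk]]] := horizontal_geodesic d0 g hp.
case: c c' {g hp hq} sc sc' px qx ek ak sk => i [a b] [i' [a' b']] /=.
rewrite /above /lower_left /= !natb_eq1E; case: a => /=; first by rewrite ltxx.
case: a' => /=; last by rewrite ltxx.
move=> sc sc' _ _ ek ak sk.
(* The path leaves from a left corner and arrives at a right one, hence one unit more than the [k]
   vertices passed. *)
exists k; split; first by rewrite -natr1; lra.
exists (if b then sts_up O i else i); split=> //.
  by rewrite iterS -ak; move: sc'; case: (b') => //; rewrite singular_up_right.
Qed.

Lemma row_saddle_Hol O d : row_saddle O d.+1 -> Hol R O (d.+1%:R, 0).
Proof.
case=> i [iS jS reg].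
have d0 : d.+1%:R != 0 :> R by rewrite pnatr_eq0.
split; first by case=> /eqP; rewrite (negbTE d0).
have path k : (k <= d)%N -> geodesic O (d.+1%:R : R, 0) (i, (0, 0))
    (k.+1%:R / d.+1%:R) (iter k (sts_right O) i, (1, 0)).
  have step j : geodesic O (d.+1%:R : R, 0) (j, (0, 0)) (1 / d.+1%:R) (j, (1, 0)).
    apply: geodesic_segment; rewrite ?divr_gt0 ?ltr0n // /in_square /= ?ler01 ?lexx //.
    by rewrite mulr0 addr0 add0r mulfVK.
  elim: k => [|k IH] kd; first exact: step.
  have -> : k.+2%:R / d.+1%:R = k.+1%:R / d.+1%:R + 1 / d.+1%:R :> R.
    by rewrite -mulrDl natr1.
  apply: geodesic_cat (IH (ltnW kd)) _ _ (step _).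
    by apply: rst_step; apply: (@glued_right _ _ O); rewrite lexx ler01.
  move=> /is_cone_pointP [c e]; rewrite singular_cornerE; apply/negP.
  have -> : c = (iter k (sts_right O) i, (true, false)).
    by apply: (@corner_point_inj R); rewrite -e.
  by apply: (reg k.+1); lia.
exists (i, (0, 0)), (iter d (sts_right O) i, (1, 0)); split.
- by apply/is_cone_pointP; exists (i, (false, false)); rewrite // -singular_corner_lower_left.
- by apply/is_cone_pointP; exists (iter d (sts_right O) i, (true, false)); rewrite // singular_cornerE.
- by have := path d (leqnn d); rewrite divff.
Qed.

Lemma same_point_int O p q : same_point O p q ->
  exists a b : int, q.2 = (p.2.1 + a%:~R, p.2.2 + b%:~R).
Proof.
elim=> [p1 q1 [i y _|i y _]|p1|p1 q1 _ [a [b e]]|p1 q1 r1 _ [a [b e]] _ [a' [b' ->]]].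
- by exists (-1)%Z, 0; rewrite /= addr0 subrr.
- by exists 0, (-1)%Z; rewrite /= addr0 subrr.
- by exists 0, 0; rewrite !addr0; case: (p1.2).
- by exists (- a), (- b); rewrite e /= !mulrNz !addrK; case: (p1.2).
- by exists (a + a'), (b + b'); rewrite e /= !mulrzDr !addrA.
Qed.

Lemma geodesic_int O v p t q : geodesic O v p t q ->
  exists a b : int, q.2 = (p.2.1 + t * v.1 + a%:~R, p.2.2 + t * v.2 + b%:~R).
Proof.
elim=> [i z z' t1 _ _ _ ->|p1 q1 q2 r1 t1 t2 _ [a [b e1]] /same_point_int [a' [b' e2]] _ _ [a2 [b2 ->]]].
  by exists 0, 0; rewrite /= !addr0.
exists (a + a' + a2), (b + b' + b2); rewrite e2 e1 /= !mulrzDr.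
by congr (_, _); ring.
Qed.

Lemma Hol_int O v : Hol R O v -> exists a b : int, v = (a%:~R, b%:~R).
Proof.
case=> _ [p [q [/is_cone_pointP [c -> _] /is_cone_pointP [c' -> _] /geodesic_int]]].
rewrite /= !mul1r => -[a [b [e1 e2]]].
exists (c'.2.1%:Z - c.2.1%:Z - a), (c'.2.2%:Z - c.2.2%:Z - b).
case: v e1 e2 => x y /= e1 e2; rewrite !mulrzBr -!pmulrn e1 e2.
by congr (_, _); ring.
Qed.

Lemma unshear_singular O : singular (unshear O) = singular O.
Proof. by rewrite -[in RHS](unshearK O) shear_singular. Qed.

(** Subtractive Euclidean algorithm: [unshear] performs a subtraction and [swap] exchanges the
    coordinates. *)
Lemma Hol_gcdn O (a b : nat) : exists2 O' : square_tiled n, #|singular O'| = #|singular O| &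
  Hol R O (a%:R, b%:R) <-> Hol R O' ((gcdn a b)%:R, 0).
Proof.
have gcdn_sub c d : (d <= c)%N -> gcdn c d = gcdn (c - d)%N d.
  by move=> dc; rewrite -[in LHS](subnK dc) gcdnC gcdnDr gcdnC.
have [m] := ubnP (a + b)%N; elim: m a b O => [//|m IH] a b O abm.
have [->|b0] := posnP b; first by exists O; rewrite ?gcdn0.
have [->|a0] := posnP a.
  by exists (swap O); rewrite ?swap_singular // gcd0n swap_HolE.
have [ba|ab] := leqP b a.
  have [|O' e h] := IH (a - b)%N b (unshear O); first by lia.
  exists O'; first by rewrite e unshear_singular.
  rewrite gcdn_sub // -h unshear_HolE.
  by rewrite -natrD subnK.
have [|O' e h] := IH (b - a)%N a (unshear (swap O)); first by lia.
exists O'; first by rewrite e unshear_singular swap_singular.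
rewrite gcdnC (gcdn_sub _ _ (ltnW ab)) -h unshear_HolE swap_HolE.
by rewrite -natrD subnK // ltnW.
Qed.

Lemma Hol_gcdz O (a b : int) : exists2 O' : square_tiled n, #|singular O'| = #|singular O| &
  Hol R O (a%:~R, b%:~R) <-> Hol R O' ((gcdz a b)%:~R, 0).
Proof.
have nonneg_a (b' : nat) O1 : exists2 O' : square_tiled n, #|singular O'| = #|singular O1| &
    Hol R O1 (a%:~R, b'%:R) <-> Hol R O' ((gcdz a b')%:~R, 0).
  case: a => a; first exact: (Hol_gcdn O1 a b').
  have [O' e h] := Hol_gcdn (reflect O1) a.+1 b'.
  exists O'; first by rewrite e card_reflect_singular.
  by rewrite -[gcdz _ _]/(Posz (gcdn a.+1 b')) -h reflect_HolE.
case: b => b; first exact: nonneg_a.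
have [O' e h] := nonneg_a b.+1 (swap (reflect (swap O))).
exists O'; first by rewrite e swap_singular card_reflect_singular swap_singular.
by rewrite -[gcdz _ _]/(gcdz a b.+1) -h swap_HolE reflect_HolE swap_HolE.
Qed.

Lemma unit_saddle O i : i \in singular O -> sts_right O i \in singular O -> Hol R O (1, 0).
Proof.
move=> iS jS; apply: (@row_saddle_Hol O 0); exists i; split=> // l; lia.
Qed.

Lemma no_unit_saddle O : (forall i, i \in singular O -> sts_right O i \notin singular O) ->
  ~ Hol R O (1, 0).
Proof.
move=> h /(horizontal_saddle ltr01) [k [/esym/eqP]].
rewrite pnatr_eq1 eqSS => /eqP -> [i [iS jS _]].
by move: (h i iS); rewrite jS.
Qed.

(** Once the direction is horizontal, the singular squares and their right neighbours are too many
    to be disjoint. *)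
Lemma Hol_primitive O (a b : int) : gcdz a b = 1 -> (n < 2 * #|singular O|)%N ->
  Hol R O (a%:~R, b%:~R).
Proof.
move=> ab1 nS; have [O' e ->] := Hol_gcdz O a b; rewrite ab1.
apply: contrapT => no.
have : sts_right O' @: singular O' \subset ~: singular O'.
  apply/subsetP => _ /imsetP [i iS ->]; rewrite inE; apply/negP => jS.
  by apply: no; apply: unit_saddle iS jS.
move=> /subset_leq_card; rewrite card_imset; last exact: perm_inj.
by have := cardsC (singular O'); rewrite card_ord e; lia.
Qed.

(** Once made horizontal, the vector has length its gcd, and a length above 1 would require a
    regular square on the way. *)
Lemma Hol_all_singular O v : singular O = setT -> Hol R O v ->
  exists a b : int, gcdz a b = 1 /\ v = (a%:~R, b%:~R).
Proof.
move=> SO /[dup] /Hol_int [a [b ->]] h; exists a, b; split=> //.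
have ab0 : gcdz a b != 0.
  apply/negP; rewrite gcdz_eq0 => /andP[/eqP a0 /eqP b0].
  by case: h => + _; rewrite a0 b0; apply.
have [O' e ho] := Hol_gcdz O a b; move/ho: h.
have SO' : singular O' = setT.
  by apply/eqP; rewrite eqEcard subsetT cardsT e SO cardsT /=.
have g0 : 0 < (gcdz a b)%:~R :> R by rewrite ltr0z lt_neqAle eq_sym ab0.
move=> /(horizontal_saddle g0) [[|k] [ek [i [_ _ reg]]]].
  by apply/eqP; rewrite -(eqr_int R) ek.
by have := reg 1%N isT; rewrite SO' inE.
Qed.

Lemma transitive_singular O : transitive_pair (sts_right O) (sts_up O).
Proof.
move=> U /set0Pn [i iU] hr hu.
apply/setP => j; rewrite in_setT -iU.
have cl x y : share_side (sts_right O) (sts_up O) x y -> (x \in U) = (y \in U).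
  by case/or4P => /eqP ->; rewrite ?(stable_inv hr) ?(stable_inv hu).
have /connectP [p pth ->] := sts_connected O i j.
elim: p i pth {iU} => [//|x p IH] i /= /andP[/cl -> /IH].
by [].
Qed.

Lemma commute_off_singular O : commute_off (singular O) (sts_right O) (sts_up O).
Proof.
move=> p; rewrite singular_up_right -aroundE => e.
have h : sts_up O (sts_right O p) \in singular O by rewrite singularE; apply/eqP.
by split.
Qed.

Lemma long_row_saddle O i : i \in singular O -> sts_right O i \notin singular O ->
  exists d, row_saddle O d.+2.
Proof.
move=> iS rS.
have ex : exists k, iter k.+1 (sts_right O) i \in singular O.
  have := iter_porbit (sts_right O) i.
  case: #|_| (card_porbit_neq0 (sts_right O) i) => // k _ e.
  by exists k; rewrite e.
have [[|k] kS kmin] := ex_minnP ex; first by rewrite /= (negbTE rS) in kS.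
exists k; exists i; split=> // -[//|l] /andP[_ lk].
by apply/negP => /kmin; lia.
Qed.

(** By transitivity some singular square has a regular neighbour to the right or above; continuing
    to the next singular square gives length at least 2. *)
Lemma nonprimitive_Hol O : singular O != set0 -> singular O != setT ->
  exists2 v, Hol R O v & ~ exists a b : int, gcdz a b = 1 /\ v = (a%:~R, b%:~R).
Proof.
move=> S0 ST.
have nonprim d (w : R * R) : w = (d.+2%:R, 0) \/ w = (0, d.+2%:R) ->
    ~ exists a b : int, gcdz a b = 1 /\ w = (a%:~R, b%:~R).
  move=> hw [a [b [ab1 ew]]].
  have [[ea eb]|[ea eb]] : (a = d.+2 /\ b = 0) \/ (a = 0 /\ b = d.+2).
    have natr_int (k : nat) (c : int) : k%:R = c%:~R :> R -> c = k.
      by move/esym; apply: (@intr_inj R c k).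
    case: hw => e; move: ew; rewrite e => -[ea eb]; [left|right].
      by split; [exact: natr_int | exact: (natr_int 0%N)].
    by split; [exact: (natr_int 0%N) | exact: natr_int].
  by move: ab1; rewrite ea eb gcdz0.
  by move: ab1; rewrite ea eb gcd0z.
have [[i [iS iN]]|noR] := pselect (exists i, i \in singular O /\ sts_right O i \notin singular O).
  have [d /row_saddle_Hol h] := long_row_saddle iS iN.
  by exists (d.+2%:R, 0) => //; apply: (nonprim d); left.
have [[i [iS iN]]|noU] := pselect (exists i, i \in singular O /\ sts_up O i \notin singular O).
  have := @long_row_saddle (swap O) i; rewrite swap_singular => /(_ iS iN) [d].
  move/row_saddle_Hol => h; exists (0, d.+2%:R); first exact/swap_HolE.
  by apply: (nonprim d); right.
case/negP: ST; apply/eqP; apply: (@transitive_singular O) => // i iS; apply: contraT => iN.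
  by case: noR; exists i.
by case: noU; exists i.
Qed.

Lemma hidden_primitive (M : {set 'I_n}) (x y : {perm 'I_n}) : has_hidden M x y ->
  forall O, sts_right O = x -> sts_up O = y -> singular O = M ->
  exists a b : int, gcdz a b = 1 /\ ~ Hol R O (a%:~R, b%:~R).
Proof.
elim=> [{}x {}y h|{}x {}y k _ IH] O er eu eM.
  exists 1, 0; split; first by rewrite gcdz0.
  by apply: no_unit_saddle => i; rewrite eM er; apply: h.
(* The pair [(x ^+ k * y, x)] is the swap of the k-th unshear, and these changes of basis preserve
   primitive vectors. *)
pose O_ l := iter l (@unshear n) O.
have rO l : sts_right (O_ l) = x by elim: l => [|l IHl] //=; rewrite invgK.
have uO l : sts_up (O_ l) = (x ^+ l * y)%g.
  elim: l => [|l IHl] /=; first by rewrite expg0 mul1g.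
  by rewrite invgK rO IHl expgS mulgA.
have sO l : singular (O_ l) = M by elim: l => [|l IHl] //=; rewrite unshear_singular.
have [a [b [ab1 nab]]] : exists a b : int, gcdz a b = 1 /\ ~ Hol R (O_ k) (a%:~R, b%:~R).
  have [| a [b [ab1 nab]]] := IH (swap (O_ k)) (uO k) (rO k); first by rewrite swap_singular sO.
  by exists b, a; rewrite gcdzC; split=> //; move/swap_HolE.
elim: k a b ab1 nab {IH} => [|k IHk] a b ab1 nab; first by exists a, b.
apply: (IHk (a + b) b); first by rewrite gcdzC gcdzDr gcdzC.
by rewrite mulrzDr; move=> h; apply: nab; apply/unshear_HolE.
Qed.

End Saddles.

Theorem few_singular_hidden (R : realType) (m : nat) : exists N, forall n (O : square_tiled n),
  #|singular O| <= m -> N < n ->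
  exists a b : int, gcdz a b = 1%R /\ ~ Hol R O (a%:~R, b%:~R)%R.
Proof.
have [N hN] := hidden_direction m; exists N => n O Sm Nn.
apply: (hidden_primitive R _ (erefl _) (erefl _) (erefl _)).
apply: hN => //; [exact: commute_off_singular|exact: transitive_singular|].
by rewrite card_ord.
Qed.

(** * Nonempty strata *)

Section OneRowSurface.

Variables (R : realType) (s : seq nat) (cs : seq (seq nat)).
Hypotheses (os : one_row s cs) (s_gt0 : 0 < size s).
Let n := size s.
Implicit Types (i j : 'I_n).

Lemma one_row_nth i : nth 0 s i < n.
Proof. by rewrite -(one_row_mem _ os) mem_nth. Qed.

Definition row_up i : 'I_n := Ordinal (one_row_nth i).

Lemma row_up_inj : injective row_up.
Proof.
move=> i j /(congr1 val) /= /eqP; rewrite nth_uniq ?(one_row_uniq os) ?ltn_ord //.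
by move/eqP/val_inj.
Qed.

Definition row_right_perm : {perm 'I_n} := perm (can_inj (@ordSK n)).
Definition row_up_perm : {perm 'I_n} := perm row_up_inj.

Lemma one_row_connected i j : connect (share_side row_right_perm row_up_perm) i j.
Proof.
have sym : connect_sym (share_side row_right_perm row_up_perm).
  apply: sym_connect_sym => x y; rewrite /share_side /=.
  by apply/idP/idP; case/or4P=> ->; rewrite ?orbT.
suff h k : connect (share_side row_right_perm row_up_perm) (Ordinal s_gt0) k.
  by apply: connect_trans (h j); rewrite sym.
case: k => k kn; elim: k kn => [|k IH] kn.
  by rewrite (_ : Ordinal _ = Ordinal kn) ?connect0 //; apply/val_inj.
apply: connect_trans (IH (ltnW kn)) (connect1 _); apply/or4P; constructor 1.
by rewrite permE; apply/eqP/val_inj; rewrite /= modn_small.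
Qed.

Definition one_row_surface : square_tiled n := SquareTiled s_gt0 one_row_connected.

Let O := one_row_surface.

Lemma one_row_last : nth 0 s n.-1 = n.-1.
Proof.
have [_ + _ _] := os; rewrite nth_last /n.
by case/lastP: (s) => [//|p x]; rewrite map_rcons !last_rcons => <-.
Qed.

Lemma one_row_around j : around O j = turn s j :> nat.
Proof.
have [i ->] : exists i, j = sts_up O (sts_right O i).
  by exists ((sts_right O)^-1 ((sts_up O)^-1 j))%g; rewrite !permKV.
rewrite aroundE /= !permE /= /turn.
have us := one_row_uniq os.
have [iS|iS] := ltnP i.+1 n.
  rewrite [i.+1 %% n]modn_small // index_uniq //.
  rewrite (take_nth 0) ?ltn_ord // map_rcons last_rcons modn_small //.
  rewrite ltn_neqAle one_row_nth andbT; apply/eqP => e.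
  have /eqP : nth 0 s i = nth 0 s n.-1 by rewrite one_row_last; lia.
  by rewrite nth_uniq ?ltn_ord ?ltn_predL // => /eqP ei; rewrite ei prednK ?ltnn in iS.
(* The last square wraps around: its right neighbour is 0 and the square above it is itself, which
   yields the default value 0 in [turn]. *)
have -> : (i : nat) = n.-1 by have := ltn_ord i; lia.
by rewrite one_row_last prednK // modnn index_uniq // take0.
Qed.

Definition cell (c : seq nat) : {set 'I_n} := [set i : 'I_n | (i : nat) \in c].

Lemma card_cell c : c \in cs -> #|cell c| = size c.
Proof.
move=> ccs; rewrite cardE -(size_map val).
have [_ _ fs _] := os.
have uc : uniq c.
  have : uniq (flatten cs) by rewrite (perm_uniq fs) (one_row_uniq os).
  by rewrite (perm_uniq (perm_flatten (perm_to_rem ccs))) cat_uniq => /and3P[].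
apply/perm_size/uniq_perm => //; first by rewrite map_inj_uniq ?enum_uniq //; apply: val_inj.
move=> x; apply/mapP/idP => [[i]|xc]; first by rewrite mem_enum inE => ? ->.
have xn : x < n by rewrite -(one_row_mem _ os) (cycle_mem os ccs).
by exists (Ordinal xn); rewrite // mem_enum inE.
Qed.

Lemma porbit_cell c j : c \in cs -> (j : nat) \in c -> porbit (around O) j = cell c.
Proof.
move=> ccs jc; have [_ _ _ /(_ c ccs) hc] := os.
have c0 : 0 < size c by case: (c) jc.
have stable i : i \in cell c -> around O i \in cell c.
  rewrite !inE one_row_around => ic.
  by rewrite -(mem_rot 1) -hc map_f.
have nth_turn k : k.+1 < size c -> nth 0 c k.+1 = turn s (nth 0 c k).
  move=> kc; rewrite -(nth_map 0 0 (turn s)) ?hc; last exact: ltnW.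
  by case: (c) kc => [//|x t] kc; rewrite rot1_cons nth_rcons /= ltnS in kc *; rewrite kc.
have in_row k : k < size c -> nth 0 c k < n.
  by move=> kc; rewrite -(one_row_mem _ os) (cycle_mem os ccs) ?mem_nth.
pose j0 : 'I_n := Ordinal (in_row 0 c0).
have reach i : (i : nat) \in c -> i \in porbit (around O) j0.
  move=> ic; have ik : index (i : nat) c < size c by rewrite index_mem.
  have -> : i = Ordinal (in_row _ ik) by apply/val_inj; rewrite /= nth_index.
  elim: (index _ _) ik => [|k IH] kc; first by rewrite (_ : Ordinal _ = j0) ?porbit_id //; apply/val_inj.
  rewrite (_ : Ordinal _ = around O (Ordinal (in_row k (ltnW kc)))).
    by rewrite porbit_around_mem IH.
  by apply/val_inj; rewrite /= one_row_around /= nth_turn.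
have -> : porbit (around O) j = porbit (around O) j0.
  by apply/eqP; rewrite eq_porbit_mem reach.
apply/setP => i; apply/idP/idP => [|]; last by rewrite inE; apply: reach.
case/porbitP => k ->; have : j0 \in cell c by rewrite inE mem_nth.
elim: k => [|k IH] h; first by rewrite expg0 perm1.
by rewrite expgSr permM; apply: stable; apply: IH.
Qed.

Lemma one_row_cell j : exists2 c, c \in cs & (j : nat) \in c.
Proof.
have [_ _ /perm_mem fs _] := os; have : (j : nat) \in flatten cs.
  by rewrite fs (one_row_mem _ os).
by case/flattenP => c; exists c.
Qed.

Definition cell_vertex c : {set corner n} := [set k | lower_left O k \in cell c].

Lemma vertex_cell k c : c \in cs -> (lower_left O k : nat) \in c ->
  vertex_of R O k = cell_vertex c.
Proof.
move=> ccs kc; rewrite vertex_ofE; apply/setP => k'; rewrite !inE.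
by rewrite eq_porbit_mem (porbit_cell ccs kc) inE.
Qed.

Lemma uniq_cell_vertices :
  uniq [seq cell_vertex c | c <- cs & 1 < size c].
Proof.
have [_ _ fs _] := os.
have uf : uniq (flatten cs) by rewrite (perm_uniq fs) (one_row_uniq os).
have lt_n c x : c \in cs -> x \in c -> x < n.
  by move=> ccs xc; rewrite -(one_row_mem _ os) (cycle_mem os ccs).
elim: cs uf lt_n => [//|c t IH] /=; rewrite cat_uniq => /and3P[_ cd ut] lt_n.
have {}IH : uniq [seq cell_vertex c0 | c0 <- t & 1 < size c0].
  by apply: IH => // c' x c't; apply: lt_n; rewrite inE c't orbT.
case: ifP => //= c1; rewrite IH andbT; apply/mapP => -[c']; rewrite mem_filter => /andP[_ c't] e.
have xc : nth 0 c 0 \in c by rewrite mem_nth // ltnW.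
have xn := lt_n c _ (mem_head _ _) xc.
have : (Ordinal xn, (false, false)) \in cell_vertex c by rewrite !inE.
rewrite e !inE /= => xc'; case/negP: cd; apply/hasP; exists (nth 0 c 0) => //.
by apply/flattenP; exists c'.
Qed.

Lemma cone_points_cells : perm_eq (enum (cone_points R O))
  [seq cell_vertex c | c <- cs & 1 < size c].
Proof.
apply: uniq_perm; [exact: enum_uniq | exact: uniq_cell_vertices | move=> V].
have card_vertex_cell c : c \in cs -> #|cell_vertex c| = 4 * size c.
  by move=> ccs; rewrite /cell_vertex card_corners card_cell.
rewrite mem_enum inE; apply/idP/mapP.
  case/andP => /imsetP [k _ ->]; have [c ccs kc] := one_row_cell (lower_left O k).
  rewrite (vertex_cell ccs kc) card_vertex_cell // => c1; exists c => //.
  by rewrite mem_filter ccs andbT -(@ltn_pmul2l 4).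
case=> c; rewrite mem_filter => /andP[c1 ccs] ->.
rewrite card_vertex_cell // (@ltn_pmul2l 4 1) // c1 andbT.
have xc : nth 0 c 0 \in c by rewrite mem_nth // ltnW.
have xn : nth 0 c 0 < n by rewrite -(one_row_mem _ os) (cycle_mem os ccs).
by apply/imsetP; exists (Ordinal xn, (false, false)); rewrite // (vertex_cell ccs).
Qed.

(** The [e] zeros stand for cycles of length 1, that is for regular vertices, which the filter on
    sizes removes. *)
Lemma one_row_stratum (alpha : seq nat) e : {in alpha, forall a, 0 < a} ->
  perm_eq (map size cs) (map succn (alpha ++ nseq e 0)) -> in_stratum R O alpha.
Proof.
move=> a0 pa; rewrite /in_stratum.
apply: perm_trans (perm_map (fun V : {set corner n} => #|V|) cone_points_cells) _.
rewrite -map_comp.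
have -> : [seq #|cell_vertex c| | c <- cs & 1 < size c] =
    [seq 4 * k | k <- [seq k <- map size cs | 1 < k]].
  rewrite filter_map -map_comp; apply/eq_in_map => c; rewrite mem_filter => /andP[_ ccs] /=.
  by rewrite /cell_vertex card_corners card_cell.
have -> : [seq 4 * a.+1 | a <- alpha] =
    [seq 4 * k | k <- [seq k <- map succn (alpha ++ nseq e 0) | 1 < k]].
  rewrite filter_map filter_cat -!map_comp (_ : [seq x <- nseq e 0 | _] = [::]).
    rewrite cats0; congr map; apply/esym/all_filterP/allP => a /a0; done.
  by elim: (e).
by apply: perm_map; apply: perm_filter.
Qed.

End OneRowSurface.

Theorem stratum_nonempty (R : realType) (alpha : seq nat) e :
  {in alpha, forall a, 0 < a} -> ~~ odd (sumn alpha) -> 0 < size alpha ->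
  exists O : square_tiled (sumn (map succn alpha) + e), in_stratum R O alpha.
Proof.
move=> a0 ev s0.
have [|s [cs [os pa]]] := @realizable_even (alpha ++ nseq e 0).
  by rewrite sumn_cat sumn_nseq mul0n addn0.
have sz : size s = sumn (map succn alpha) + e.
  have [_ _ /perm_size <- _] := os.
  rewrite size_flatten /shape (perm_sumn pa) map_cat sumn_cat map_nseq sumn_nseq mul1n.
  by [].
have s_gt0 : 0 < size s by rewrite sz; case: (alpha) s0.
rewrite -sz; exists (one_row_surface os s_gt0).
exact: one_row_stratum pa.
Qed.

Theorem stratum_no_unit_saddle (R : realType) (alpha : seq nat) :
  {in alpha, forall a, 0 < a} -> ~~ odd (sumn alpha) -> 0 < size alpha ->
  exists O : square_tiled (sumn (map succn alpha)).*2,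
    in_stratum R O alpha /\ ~ Hol R O (1, 0)%R.
Proof.
move=> a0 ev s0; have [s [cs [os pa]]] := realizable_even ev.
have sz : size s = sumn (map succn alpha).
  by have [_ _ /perm_size <- _] := os; rewrite size_flatten /shape (perm_sumn pa).
have os2 := one_row_stretch os.
have sz2 : size (stretch s) = (sumn (map succn alpha)).*2.
  by rewrite -sz /stretch; elim: (s) => //= x t ->; rewrite doubleS.
have s_gt0 : 0 < size (stretch s) by rewrite sz2; case: (alpha) s0.
rewrite -sz2; exists (one_row_surface os2 s_gt0); split.
  apply: (@one_row_stratum _ _ _ _ _ _ (size s)) => //.
  rewrite !map_cat -map_comp; apply: perm_cat.
    by rewrite (eq_map (g := size)) // => c /=; rewrite size_map.
  by rewrite -map_comp map_nseq; elim: (s) => //= x t; rewrite perm_cons.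
(* Odd squares are fixed by [turn], hence regular; a singular square is therefore even, and its
   right neighbour is odd, without wrapping as the size is even. *)
apply: no_unit_saddle => i iS.
have regular (j : 'I_(size (stretch s))) : odd j -> j \notin singular (one_row_surface os2 s_gt0).
  move=> jo; rewrite singularE negbK; apply/eqP/val_inj; rewrite /= one_row_around.
  have [c ccs jc] := one_row_cell os2 j.
  have [_ _ _ /(_ c ccs) hc] := os2.
  move: ccs; rewrite mem_cat => /orP [] /mapP [d ds e]; rewrite {}e in hc jc.
    by case/mapP: jc => x _ e; rewrite e odd_double in jo.
  by move: hc jc; rewrite inE => /= -[h] /eqP ->.
have ev_i : ~~ odd i by apply: contraL iS => /regular.
have i_lt : i.+1 < size (stretch s).
  by move: (nat_of_ord i) ev_i (ltn_ord i) => k; rewrite sz2; lia.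
by apply: regular; rewrite /= permE /= modn_small.
Qed.

(* Imported late because classical_sets shadows the names of finset. *)
From mathcomp Require Import classical_sets.

Theorem theorem4p5 (R : realType) (s : nat) (alpha : s.-tuple nat) (g : nat)
    (s_ge1 : (1 <= s)%N)
    (alpha_gt0 : forall i : 'I_s, (0 < tnth alpha i)%N)
    (alpha_even : ~~ odd (\sum_(i < s) tnth alpha i)%N)
    (alpha_genus : (\sum_(i < s) tnth alpha i = 2 * g - 2)%N) :
  [/\ (* (1) *)
      forall n : nat, (n < 2 * g + s - 2)%N ->
        forall O : square_tiled n, ~ in_stratum R O alpha,
      (* (2) *)
      forall n : nat, (2 * g + s - 2 <= n)%N ->
        (n = (2 * g + s - 2)%N <->
         forall O : square_tiled n, in_stratum R O alpha -> Hol R O = RP R),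
      (* (3) *)
      forall n : nat, (2 * g + s - 2 < n <= 4 * g + 2 * s - 5)%N ->
        forall O : square_tiled n, in_stratum R O alpha ->
          visibility_torus R O /\ (RP R `<` Hol R O)%classic,
      (* (4) *)
      forall n : nat, n = (4 * g + 2 * s - 4)%N ->
        exists O : square_tiled n,
          in_stratum R O alpha /\ ~ visibility_torus R O
    & (* (5) *)
      exists N : nat, forall n : nat, (N < n)%N ->
        forall O : square_tiled n, in_stratum R O alpha ->
          ~ visibility_torus R O /\ exists v : R * R, (RP R `\` Hol R O)%classic v].
Proof.
set m := (2 * g + s - 2)%N.
have sum_alpha : sumn alpha = (\sum_(i < s) tnth alpha i)%N by rewrite sumnE big_tuple.
have alpha_pos : {in (alpha : seq nat), forall a, (0 < a)%N} by move=> a /tnthP [i ->].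
have alpha_ne : (0 < size alpha)%N by rewrite size_tuple.
have alpha_ev : ~~ odd (sumn alpha) by rewrite sum_alpha.
(* This makes the sum positive, so the truncated subtraction in [2 * g - 2] is a genuine one. *)
have sum_s : (s <= sumn alpha)%N.
  rewrite -[X in (X <= _)%N](size_tuple alpha).
  by elim: (tval alpha) alpha_pos => //= a t IH h; rewrite -add1n leq_add ?h ?mem_head //;
    apply: IH => b bt; apply: h; rewrite inE bt orbT.
have sum_succ (t : seq nat) : sumn (map succn t) = (sumn t + size t)%N.
  by elim: t => //= a t ->; rewrite addSn addnS addnA.
have m_def : sumn (map succn alpha) = m.
  by rewrite sum_succ sum_alpha alpha_genus size_tuple /m; move: sum_s; rewrite sum_alpha alpha_genus; lia.
have m_gt0 : (0 < m)%N by rewrite -m_def sum_succ; lia.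
have cardS n (O : square_tiled n) : in_stratum R O alpha -> #|singular O| = m.
  by rewrite -m_def; apply: card_singular.
have primitive_Hol n (O : square_tiled n) : in_stratum R O alpha -> (n < 2 * m)%N ->
    visibility_torus R O.
  by move=> hO nm v [a [b [ab1 ->]]]; apply: Hol_primitive; rewrite ?(cardS _ _ hO).
have other_Hol n (O : square_tiled n) : in_stratum R O alpha -> (m < n)%N ->
    exists2 v, Hol R O v & ~ RP R v.
  move=> hO nm; apply: nonprimitive_Hol.
    by rewrite -card_gt0 (cardS _ _ hO).
  by apply/eqP => ST; move: nm; rewrite -(cardS _ _ hO) ST cardsT card_ord ltnn.
split.
- move=> n nm O hO; have := max_card (mem (singular O)).
  by rewrite card_ord (cardS _ _ hO) leqNgt nm.
- move=> n mn; split=> [nm O hO|h].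
    have ST : singular O = finset.setT.
      by apply/eqP; rewrite eqEcard finset.subsetT cardsT card_ord (cardS _ _ hO) nm /=.
    apply/seteqP; split=> v; first exact: Hol_all_singular.
    by apply: primitive_Hol => //; rewrite nm; lia.
  (* For n > m the stratum does contain a surface with n squares, and it has a nonprimitive holonomy
     vector. *)
  apply/eqP; rewrite eqn_leq mn andbT leqNgt; apply/negP => nm.
  have [O hO] := stratum_nonempty R (n - m) alpha_pos alpha_ev alpha_ne.
  rewrite m_def (subnKC mn) in O hO.
  by have [v vO []] := other_Hol n O hO nm; rewrite -(h O hO).
- move=> n nm O hO; have vis : visibility_torus R O by apply: primitive_Hol => //; lia.
  split=> //; split=> // sub.
  by have [v /sub vRP []] := other_Hol n O hO ltac:(lia).
- move=> n ->; have := stratum_no_unit_saddle R alpha_pos alpha_ev alpha_ne.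
  rewrite m_def (_ : m.*2 = 4 * g + 2 * s - 4)%N; last by rewrite /m; lia.
  case=> O [hO no]; exists O; split=> // vis; apply: no; apply: vis.
  by exists 1, 0; rewrite gcdz0.
have [N hN] := few_singular_hidden R m.
exists N => n Nn O hO.
have [|a [b [ab1 nab]]] := hN n O _ Nn; first by rewrite (cardS _ _ hO).
have vRP : RP R (a%:~R, b%:~R)%R by exists a, b.
by split; [move/(_ _ vRP) | exists (a%:~R, b%:~R)%R].
Qed.
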